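(* Let $d\ge1$ and $N\ge2$ be integers and let $T^d_{2N}$ be the $d$-dimensional torus with vertex set $(\mathbb Z/2N\mathbb Z)^d$, where $(x_1,\dots,x_d)$ is adjacent to the $2d$ vertices obtained by changing exactly one coordinate by $\pm1$. Consider the two marked sets (each of size $(2N)^d/2$) Case 1: $M=\{(x_1,\dots,x_d)\mid x_1+\dots+x_d \text{ even}\}$; Case 2: $M=\{(x_1,\dots,x_d)\mid 0\le x_d\le N-1\}$ (representatives $x_i\in\{0,\dots,2N-1\}$), and let $W'_1$, $W'_2$ be the corresponding search time evolution matrices. Then for real $u\in(0,1)$: $$\zeta(W'_1,T^d_{2N},u)^{-1}=\lim_{N\to\infty}\zeta(W'_1,T^d_{2N},u)^{-1}=\exp\Big[\Big(2d-\tfrac12\Big)\log(1-u)+\log(1+u)\Big];$$ $$\zeta(W'_2,T^d_{2N},u)^{-1}=\exp\Big[\Big(2d-\tfrac12\Big)\log(1-u)+\frac{1}{(2N)^d}\sum_{k_1,\dots,k_{d-1}=1}^{2N}\sum_{k_d=1}^{N}\log\Big\{(1+u)^2-\frac{4u}{d^2}\Big(\sum_{i=1}^{d-1}\cos\frac{(k_i-1)\pi}{N}+\cos\frac{k_d\pi}{N+1}\Big)^2\Big\}\Big];$$ $$\lim_{N\to\infty}\zeta(W'_2,T^d_{2N},u)^{-1}=\exp\Big[\Big(2d-\tfrac12\Big)\log(1-u)+\frac12\int_{[0,2\pi)^d}\log\Big\{(1+u)^2-\frac{4u}{d^2}\Big(\sum_{i=1}^{d-1}\cos\theta_i+\cos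\frac{\theta_d}{2}\Big)^2\Big\}\frac{d\theta_1}{2\pi}\cdots\frac{d\theta_d}{2\pi}\Big].$$
   Context: Search time evolution matrix. Let $G=(X,E)$ be a connected simple graph with $\epsilon$ edges, $d_G(x)$ the degree of $x$, and $M_X\subset X$ a set of marked vertices, $|M_X|=m$. Let $Y=\{x'\mid x\in X\}$ be a disjoint copy of $X$, $M_Y=\{x'\mid x\in M_X\}$, $E'=\{\{x,y'\},\{x',y\}\mid\{x,y\}\in E\}$, $E_2=\{\{x,x'\}\mid x\in M_X\}$, $E_M=E'\cup E_2$ ($|E_M|=2\epsilon+m$). Define the $(2\epsilon+m)\times|X|$ matrix $K$ by $K_{e,x}=1/\sqrt{d_G(x)}$ if $x\in e$, $x\notin M_X$; $K_{e,x}=1$ if $x\in e$ and $e\in E_2$; $0$ otherwise; and $L$ (columns indexed by $Y$) by $L_{e,x'}=1/\sqrt{d_G(x)}$ if $x'\in e$, $x'\notin M_Y$; $1$ if $x'\in e$ and $e\in E_2$; $0$ otherwise. Then $W'=(2LL^\top-I_{2\epsilon+m})(2KK^\top-I_{2\epsilon+m})$. Here $G=T^d_{2N}$ ($\epsilon=d(2N)^d$) and $M_X=M$. Zeta function: $\zeta(U,T^d_{2N},u)=\det(I_{2d(2N)^d+m}-uU)^{-1/(2N)^d}$. *)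

(* Defs.v *)
From HB Require Import structures.
From mathcomp Require Import all_boot all_order all_algebra.
From mathcomp Require Import all_classical all_reals all_analysis.
Set Implicit Arguments. Unset Strict Implicit. Unset Printing Implicit Defensive.
Import Order.TTheory GRing.Theory Num.Theory.
Import numFieldNormedType.Exports.
Local Open Scope ring_scope.
Local Open Scope classical_set_scope.

Section Search.
Variables (R : realType) (V : finType) (adj : rel V) (M : {set V}).

Definition deg (x : V) : nat := #|[set y | adj x y]|.

(* E' : the edge {x, y'} (and, for the reversed pair, {y, x'}) of the
   bipartite double cover corresponds to the ordered adjacent pair (x, y). *)
Definition arcT := {p : V * V | adj p.1 p.2}.
(* E_2 : the edge {x, x'} for x marked *)
Definition markT := {x : V | x \in M}.
Definition EM := (arcT + markT)%type.

Definition Kentry (e : EM) (x : V) : R :=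
  match e with
  | inl a => if (x == (val a).1) && (x \notin M) then (Num.sqrt (deg x)%:R)^-1 else 0
  | inr z => if x == val z then 1 else 0
  end.

Definition Lentry (e : EM) (x : V) : R :=
  match e with
  | inl a => if (x == (val a).2) && (x \notin M) then (Num.sqrt (deg x)%:R)^-1 else 0
  | inr z => if x == val z then 1 else 0
  end.

Definition Kmx : 'M[R]_(#|{: EM}|, #|{: V}|) :=
  \matrix_(i, j) Kentry (enum_val i) (enum_val j).
Definition Lmx : 'M[R]_(#|{: EM}|, #|{: V}|) :=
  \matrix_(i, j) Lentry (enum_val i) (enum_val j).

Definition Wsearch : 'M[R]_(#|{: EM}|) :=
  (2%:R *: (Lmx *m Lmx^T) - 1%:M) *m (2%:R *: (Kmx *m Kmx^T) - 1%:M).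

End Search.

Definition zeta (R : realType) (m n : nat) (U : 'M[R]_m) (u : R) : R :=
  powR (\det (1%:M - u *: U)) (- (n%:R)^-1).

Definition torus_adj (d N : nat) : rel {ffun 'I_d -> 'I_(2 * N)} :=
  fun x y => [exists i : 'I_d,
     ((val (y i) == (val (x i)).+1 %% (2 * N))%N || (val (x i) == (val (y i)).+1 %% (2 * N))%N)
     && [forall j : 'I_d, (j != i) ==> (y j == x j)]].

Definition M1 (d N : nat) : {set {ffun 'I_d -> 'I_(2 * N)}} :=
  [set x : {ffun 'I_d -> 'I_(2 * N)} | ~~ odd (\sum_(i < d) val (x i))%N].

(* Case 2 : 0 <= x_d <= N - 1  (x_d is the coordinate of index d-1) *)
Definition M2 (d N : nat) : {set {ffun 'I_d -> 'I_(2 * N)}} :=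
  [set x : {ffun 'I_d -> 'I_(2 * N)} | [forall i : 'I_d, (val i == d.-1) ==> (val (x i) < N)%N]].

Definition W1 (R : realType) (d N : nat) :=
  Wsearch R (@torus_adj d N) (M1 d N).
Definition W2 (R : realType) (d N : nat) :=
  Wsearch R (@torus_adj d N) (M2 d N).

(* iterated integral over [0, 2pi)^n with normalised measure d theta / (2 pi);
   theta_1 is the head of the list *)
Fixpoint torus_int (R : realType) (n : nat) (f : seq R -> R) : R :=
  match n with
  | 0 => f [::]
  | n'.+1 => (2 * pi)^-1 *
      Rintegral (@lebesgue_measure R) `[0, 2 * pi[
        (fun t : R => torus_int n' (fun s => f (t :: s)))
  end.

(* Main.v *)
(** With [T := L^T K], the matrix [1 - u W'] is [1 - u] times a perturbation of
    the identity of rank twice the number of vertices, so Sylvester's identity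
    reduces its determinant to that of [(1 + u)^2 - 4 u T^2]. The matrix [T] is
    the identity on marked vertices and the normalised adjacency matrix of the
    unmarked subgraph elsewhere. In case 1 the unmarked subgraph has no edges.
    In case 2 it is the product of [d - 1] cycles of length [2N] with a path of
    length [N], diagonalised by products of the real Hartley modes
    [cos t + sin t] of the cycles and the sine modes of the path. Taking
    logarithms turns the determinant into a sum over the spectrum; its integrand
    is Lipschitz, hence the sums, seen as iterated quadratures, converge to the
    iterated integral one coordinate at a time. *)

Require Import Defs.
From HB Require Import structures.
From mathcomp Require Import all_boot all_order all_algebra.
From mathcomp Require Import all_classical all_reals all_analysis.
From mathcomp Require Import ring lra zify.
Import Order.TTheory GRing.Theory Num.Theory.
Import numFieldNormedType.Exports.
Local Open Scope ring_scope.
Local Open Scope classical_set_scope.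

(** * Determinants *)

(** Sylvester's identity: the block matrix with rows [1, -A] and [B, 1] has two block triangular
    factorisations, one for each side. *)
Lemma det_1D_mulmxC (R : comNzRingType) m n (A : 'M[R]_(m, n)) (B : 'M[R]_(n, m)) :
  \det (1%:M + A *m B) = \det (1%:M + B *m A).
Proof.
have e1 : block_mx 1%:M (- A) B 1%:M =
    block_mx 1%:M 0 B 1%:M *m block_mx 1%:M (- A) 0 (1%:M + B *m A).
  rewrite mulmx_block !mul1mx !mulmx1 ?mul0mx ?mulmx0 ?addr0 mulmxN addrCA.
  by rewrite addNr addr0.
have e2 : block_mx 1%:M (- A) B 1%:M =
    block_mx (1%:M + A *m B) (- A) 0 1%:M *m block_mx 1%:M 0 B 1%:M.
  rewrite mulmx_block ?mul1mx ?mul0mx ?mulmx1 ?mulmx0 ?add0r ?addr0 mulNmx.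
  by rewrite addrK.
have := congr1 determinant e1; rewrite e2 !det_mulmx !det_lblock !det_ublock !det1.
by rewrite !mul1r !mulr1.
Qed.

(** Right multiplication by the block matrix with rows [c, 0] and [-C, 1], of determinant [c ^+ n],
    clears the lower left block because [c%:M] commutes with [C]; then [c ^+ n] cancels. *)
Lemma det_block_scalar (F : fieldType) n (A B C : 'M[F]_n) (c : F) : c != 0 ->
  \det (block_mx A B C c%:M) = \det (c *: A - B *m C).
Proof.
move=> c0; have cn0 : c ^+ n != 0 by rewrite expf_neq0.
apply: (mulIf cn0); rewrite -{1}(det_scalar n c) -(mulr1 (\det c%:M)).
rewrite -(det1 F n) -(det_lblock _ (- C)) -det_mulmx mulmx_block.
rewrite !mulmx1 !mulmx0 !add0r mulmxN mul_mx_scalar mulmxN mul_mx_scalar mul_scalar_mx.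
by rewrite addrN det_ublock det_scalar.
Qed.

(** Once [1 - uW'] is written as [(1 - u)(1 + c A B)] with [A = [L K]] of width [2n], Sylvester's
    identity leaves a [2n] by [2n] block determinant whose lower right block is scalar. The power
    [2 * n] stays on the left so that no exponent [m - 2 * n] has to be formed. *)
Lemma det_two_reflections (F : fieldType) m n (K L : 'M[F]_(m, n)) (u : F) :
  K^T *m K = 1%:M -> L^T *m L = 1%:M -> u != 1 -> u != -1 ->
  (1 - u) ^+ (2 * n) *
    \det (1%:M - u *: ((2%:R *: (L *m L^T) - 1%:M) *m (2%:R *: (K *m K^T) - 1%:M))) =
  (1 - u) ^+ m *
    \det (((1 + u) ^+ 2)%:M - (4 * u) *: ((L^T *m K) *m (L^T *m K)^T)).
Proof.
move=> KK LL u1 uN1; set T := L^T *m K.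
have nu1 : 1 - u != 0 by rewrite subr_eq0 eq_sym.
have nu2 : 1 + u != 0 by rewrite addrC -(opprK 1) subr_eq0.
(* Chosen so that [(1 - u) * c = 2 * u], the coefficient of [L L^T] and of [K K^T] in [1 - uW'];
   [u != -1] keeps [1 + c] nonzero. *)
pose c := 2 * u / (1 - u).
have c1 : 1 + c = (1 + u) / (1 - u) by rewrite /c; field.
have c1n0 : 1 + c != 0 by rewrite c1 mulf_neq0 // invr_eq0.
(* The cross term [L T K^T] of the two reflections is absorbed into the upper block of [B]. *)
pose A := row_mx L K; pose B := col_mx (L^T - 2 *: (T *m K^T)) K^T.
have WE : 1%:M - u *: ((2%:R *: (L *m L^T) - 1%:M) *m (2%:R *: (K *m K^T) - 1%:M))
   = (1 - u) *: (1%:M + (c *: A) *m B).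
  have -> : (2%:R *: (L *m L^T) - 1%:M) *m (2%:R *: (K *m K^T) - 1%:M) =
     4 *: (L *m (T *m K^T)) - 2 *: (L *m L^T) - 2 *: (K *m K^T) + 1%:M.
    rewrite mulmxBl mulmxBr !mulmx1 mul1mx -scalemxAl -scalemxAr scalerA.
    by rewrite /T !mulmxA -natrM opprB addrA addrAC.
  rewrite -scalemxAl mul_row_col (scalerDr (1 - u)) scalerA.
  have -> : (1 - u) * c = 2 * u by rewrite /c; field.
  rewrite mulmxBr -scalemxAr; apply/matrixP=> i j; rewrite !mxE.
  set a := (\sum_ _ _); set b := \sum_ _ _; set e := \sum_ _ _; ring.
rewrite WE detZ det_1D_mulmxC mulrCA; congr (_ * _).
have BA : B *m (c *: A) =
   block_mx (c *: (1%:M - 2 *: (T *m T^T))) (- c *: T) (c *: T^T) c%:M.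
  rewrite -scalemxAr /A /B mul_col_row !mulmxBl KK LL -!scalemxAl -!mulmxA KK mulmx1.
  rewrite -[L^T *m K]/T scale_block_mx scalemx1 trmx_mul trmxK.
  congr block_mx; rewrite scaleNr -scalerN; congr (_ *: _).
  by rewrite scaler_nat mulr2n opprD addNKr.
have -> : (1%:M : 'M[F]_(n + n)) = block_mx 1%:M 0 0 1%:M by rewrite -scalar_mx_block.
rewrite BA add_block_mx !add0r -raddfD /= det_block_scalar // -scalemxAl -scalemxAr.
rewrite exprM -detZ.
congr (\det _); apply/matrixP=> i j; rewrite !mxE.
set a := (\sum_ _ _); set e := (1 *+ _); rewrite !c1 /c.
by case: (i == j); rewrite /= ?mulr1n ?mulr0n; field.
Qed.

Lemma sum_pred1r (A : nmodType) (I : finType) (P : pred I) (F : I -> A) (x : I) :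
  (forall i, i != x -> F i = 0) ->
  \sum_(i | P i) F i = if P x then F x else 0.
Proof.
move=> F0; case: ifP => Px; first by rewrite (bigD1 x) //= big1 ?addr0 // => i /andP[_ /F0].
by rewrite big1 // => i Pi; apply: F0; apply: contraFneq Px => <-.
Qed.

Lemma big_enum_valT (A : Type) (idx : A) (op : Monoid.com_law idx) (V : finType)
    (G : V -> A) :
  \big[op/idx]_(i < #|{: V}|) G (enum_val i) = \big[op/idx]_x G x.
Proof. by rewrite -(big_enum_val G); apply: eq_bigl. Qed.

(** Indexing the eigenvectors by [V] itself makes their matrix [P] square, and [P^T P] is diagonal
    with nonzero entries, so [P] is invertible without normalisation. From [T P = P D] the factor
    [\det P] cancels. *)
Lemma det_orthogonal_eigenbasis (F : fieldType) (V : finType) (t phi : V -> V -> F)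
    (lam : V -> F) (a b : F) :
  (forall k l, k != l -> \sum_x phi k x * phi l x = 0) ->
  (forall k, \sum_x phi k x ^+ 2 != 0) ->
  (forall k x, \sum_y t x y * phi k y = lam k * phi k x) ->
  let T := \matrix_(i < #|{: V}|, j < #|{: V}|) t (enum_val i) (enum_val j) in
  \det (a%:M - b *: (T *m T)) = \prod_k (a - b * lam k ^+ 2).
Proof.
move=> orth nz eig T.
pose P := \matrix_(i < #|{: V}|, j < #|{: V}|) phi (enum_val j) (enum_val i).
pose D := diag_mx (\row_(j < #|{: V}|) lam (enum_val j)).
have TP : T *m P = P *m D.
  apply/matrixP => i j; rewrite mul_mx_diag !mxE.
  under eq_bigr do rewrite !mxE.
  by rewrite (big_enum_valT _ _ _ _ (fun y => t (enum_val i) y * phi (enum_val j) y)) eig mulrC.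
have PP : P^T *m P = diag_mx (\row_(j < #|{: V}|) \sum_x phi (enum_val j) x ^+ 2).
  apply/matrixP => i j; rewrite !mxE.
  under eq_bigr do rewrite !mxE.
  rewrite (big_enum_valT _ _ _ _ (fun y => phi (enum_val i) y * phi (enum_val j) y)).
  case: eqP => [->|/eqP ij]; first by rewrite mulr1n.
  by rewrite mulr0n orth // (inj_eq enum_val_inj).
have detP : \det P != 0.
  have : \det (P^T *m P) != 0.
    by rewrite PP det_diag; apply/prodf_neq0 => i _; rewrite mxE nz.
  by rewrite det_mulmx det_tr mulf_eq0 orbb.
apply: (mulIf detP); rewrite -det_mulmx mulmxBl -scalemxAl -mulmxA TP mulmxA TP.
have -> : a%:M *m P - b *: (P *m D *m D) = P *m (a%:M - b *: (D *m D)).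
  by rewrite mulmxBr -scalemxAr mulmxA mul_mx_scalar mul_scalar_mx.
rewrite det_mulmx mulrC; congr (_ * _).
have -> : a%:M - b *: (D *m D) =
    diag_mx (\row_(j < #|{: V}|) (a - b * lam (enum_val j) ^+ 2)).
  rewrite mulmx_diag; apply/matrixP => i j; rewrite !mxE.
  by case: (i == j); rewrite ?mulr1n ?mulr0n ?mulr0 ?subr0.
rewrite det_diag; under eq_bigr do rewrite mxE.
by rewrite (big_enum_valT _ _ _ _ (fun k => a - b * lam k ^+ 2)).
Qed.

(** * Search matrices of regular graphs *)

Lemma degE (V : finType) (adj : rel V) x : deg adj x = #|adj x|.
Proof. by apply: eq_card => y; apply/idP/idP => [/set_mem|/mem_set]. Qed.

Section SearchWalk.
Variables (R : realType) (V : finType) (adj : rel V) (M : {set V}) (r : nat).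
Hypothesis adj_sym : symmetric adj.
Hypothesis r_gt0 : (0 < r)%N.
Hypothesis deg_r : forall x, deg adj x = r.

Lemma sum_edges (A : nmodType) (F : Defs.EM adj M -> A) (f : V -> V -> A) (g : V -> A) :
  (forall a, F (inl a) = f (val a).1 (val a).2) -> (forall z, F (inr z) = g (val z)) ->
  \sum_e F e = \sum_x \sum_(y | adj x y) f x y + \sum_(z in M) g z.
Proof.
move=> Ff Fg; rewrite big_sumType; congr (_ + _).
  under eq_bigr do rewrite Ff.
  rewrite pair_big_dep /=.
  by rewrite -(big_sub (fun p => adj p.1 p.2) (fun p => f p.1 p.2)).
under eq_bigr do rewrite Fg.
by rewrite -(big_sub (fun z => z \in M) g).
Qed.

Lemma card_edges : #|{: Defs.EM adj M}| = (r * #|{: V}| + #|M|)%N.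
Proof.
rewrite card_sum !card_sig; congr (_ + _)%N.
rewrite -sum1_card -(pair_big_dep xpredT adj (fun _ _ => 1%N)) /=.
rewrite (eq_bigr (fun _ => r)) => [|x _]; first by rewrite sum_nat_const mulnC.
by rewrite -(deg_r x) degE sum1_card.
Qed.

(** Entries of [T = L^T K] when the graph is [r]-regular, as [walk_mxE] shows. *)
Definition walk_entry (x y : V) : R :=
  if x \in M then (x == y)%:R
  else if (y \notin M) && adj x y then r%:R^-1 else 0.

Let sq : (Num.sqrt r%:R)^-1 * (Num.sqrt r%:R)^-1 = r%:R^-1 :> R.
Proof. by rewrite -invfM -expr2 sqr_sqrtr. Qed.

Let kk (x : V) : R := if x \notin M then (Num.sqrt r%:R)^-1 else 0.

Let sum_marks (x y : V) :
  \sum_(z in M) ((x == z)%:R * (y == z)%:R : R) = ((x == y) && (x \in M))%:R.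
Proof.
rewrite (sum_pred1r _ _ _ _ x) => [|z /negPf zx]; last by rewrite eq_sym zx mul0r.
by rewrite eqxx mul1r (eq_sym y) andbC; case: (x \in M).
Qed.

(** One formula serves all three products of [K] and [L]: on an arc the entries depend only on its
    endpoints, and the edges of [E_2] contribute the identity on [M]. *)
Let sum_entries (e1 e2 : Defs.EM adj M -> V -> R) (a1 a2 : V -> V -> V -> R) x y :
  (forall a z, e1 (inl a) z = a1 (val a).1 (val a).2 z) ->
  (forall a z, e2 (inl a) z = a2 (val a).1 (val a).2 z) ->
  (forall w z, e1 (inr w) z = (z == val w)%:R) ->
  (forall w z, e2 (inr w) z = (z == val w)%:R) ->
  \sum_e e1 e x * e2 e y =
  \sum_a \sum_(b | adj a b) a1 a b x * a2 a b y + ((x == y) && (x \in M))%:R.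
Proof.
move=> h1 h2 h3 h4; rewrite -sum_marks.
apply: (@sum_edges R (fun e => e1 e x * e2 e y) (fun a b => a1 a b x * a2 a b y)
  (fun z => (x == z)%:R * (y == z)%:R)) => [a|z]; first by rewrite h1 h2.
by rewrite h3 h4.
Qed.

Let KentryE a z : Kentry R (inl a : Defs.EM adj M) z = (z == (val a).1)%:R * kk z.
Proof. by rewrite /= deg_r /kk; case: (z == _); rewrite ?mul1r ?mul0r. Qed.
Let LentryE a z : Lentry R (inl a : Defs.EM adj M) z = (z == (val a).2)%:R * kk z.
Proof. by rewrite /= deg_r /kk; case: (z == _); rewrite ?mul1r ?mul0r. Qed.
Let KentryrE w z : Kentry R (inr w : Defs.EM adj M) z = (z == val w)%:R.
Proof. by rewrite /=; case: (z == _). Qed.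
Let LentryrE w z : Lentry R (inr w : Defs.EM adj M) z = (z == val w)%:R.
Proof. by rewrite /=; case: (z == _). Qed.

Let deg_norm x : \sum_(b | adj x b) kk x * kk x = (x \notin M)%:R.
Proof.
rewrite sumr_const; have -> : #|adj x| = r by rewrite -(deg_r x) degE.
rewrite /kk; case: (x \in M) => /=; first by rewrite mulr0 mul0rn.
by rewrite sq -[_ *+ r]mulr_natr mulVf // pnatr_eq0 -lt0n.
Qed.

(** Each edge contains exactly one vertex of the first copy, so distinct columns have disjoint
    supports. An unmarked column has [r] entries of square [1/r], a marked one a single entry 1. *)
Lemma Kmx_isometry : (Kmx R adj M)^T *m Kmx R adj M = 1%:M.
Proof.
apply/matrixP => i j; rewrite !mxE; under eq_bigr do rewrite !mxE.
set x := enum_val i; set y := enum_val j.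
rewrite (big_enum_valT _ _ _ _ (fun e => Kentry R e x * Kentry R e y)).
rewrite (sum_entries _ _ (fun a _ z => (z == a)%:R * kk z)
  (fun a _ z => (z == a)%:R * kk z)) //.
rewrite (sum_pred1r _ _ _ _ x) => [|a /negPf ax]; last first.
  by rewrite big1 // => b _; rewrite eq_sym ax !mul0r.
rewrite /= eqxx -(inj_eq enum_val_inj i) -/x -/y (eq_sym y); case: eqP => [<-|_].
  under eq_bigr do rewrite !mul1r.
  by rewrite deg_norm /= addrC -natrD; case: (x \in M).
by rewrite addr0 big1 // => b _; rewrite mul0r mulr0.
Qed.

Lemma Lmx_isometry : (Lmx R adj M)^T *m Lmx R adj M = 1%:M.
Proof.
apply/matrixP => i j; rewrite !mxE; under eq_bigr do rewrite !mxE.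
set x := enum_val i; set y := enum_val j.
rewrite (big_enum_valT _ _ _ _ (fun e => Lentry R e x * Lentry R e y)).
rewrite (sum_entries _ _ (fun _ b z => (z == b)%:R * kk z)
  (fun _ b z => (z == b)%:R * kk z)) //.
(* [L] charges an arc at its target, so the sum is reordered by target; symmetry of [adj] then gives
   [r] arcs into [x]. *)
rewrite (exchange_big_dep predT) //=.
rewrite (sum_pred1r _ _ _ _ x) => [|a /negPf ax]; last first.
  by rewrite big1 // => b _; rewrite eq_sym ax !mul0r.
rewrite /= eqxx -(inj_eq enum_val_inj i) -/x -/y (eq_sym y); case: eqP => [<-|_].
  under eq_bigl do rewrite adj_sym.
  under eq_bigr do rewrite !mul1r.
  by rewrite deg_norm /= addrC -natrD; case: (x \in M).
by rewrite addr0 big1 // => b _; rewrite mul0r mulr0.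
Qed.

(** [L] charges arcs at the target and [K] at the source, so the only arc that can contribute at
    [(x, y)] is the one from [y] to [x], and only when both ends are unmarked. *)
Lemma walk_mxE : (Lmx R adj M)^T *m Kmx R adj M =
  \matrix_(i, j) walk_entry (enum_val i) (enum_val j).
Proof.
apply/matrixP => i j; rewrite !mxE; under eq_bigr do rewrite !mxE.
set x := enum_val i; set y := enum_val j.
rewrite (big_enum_valT _ _ _ _ (fun e => Lentry R e x * Kentry R e y)).
rewrite (sum_entries _ _ (fun _ b z => (z == b)%:R * kk z)
  (fun a _ z => (z == a)%:R * kk z)) //.
rewrite (sum_pred1r _ _ _ _ y) => [|a /negPf ay]; last first.
  by rewrite big1 // => b _; rewrite (eq_sym y) ay !mul0r mulr0.
rewrite (sum_pred1r _ _ _ _ x) => [|b /negPf bx]; last by rewrite (eq_sym x) bx !mul0r.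
rewrite /= !eqxx !mul1r adj_sym /walk_entry /kk.
case: (x \in M); case: (y \in M); case: (adj x y); case: (x == y);
  by rewrite /= ?mulr0 ?mul0r ?addr0 ?add0r ?sq.
Qed.

Lemma walk_mx_tr :
  (\matrix_(i < #|{: V}|, j < #|{: V}|) walk_entry (enum_val i) (enum_val j))^T =
  \matrix_(i, j) walk_entry (enum_val i) (enum_val j).
Proof.
apply/matrixP => i j; rewrite !mxE /walk_entry adj_sym (eq_sym (enum_val j)).
by case: eqVneq => [->|_] //; case: (enum_val i \in M); case: (enum_val j \in M).
Qed.

Lemma det_search (u : R) (phi : V -> V -> R) (lam : V -> R) :
  0 < u < 1 ->
  (forall k l, k != l -> \sum_x phi k x * phi l x = 0) ->
  (forall k, \sum_x phi k x ^+ 2 != 0) ->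
  (forall k x, \sum_y walk_entry x y * phi k y = lam k * phi k x) ->
  (1 - u) ^+ (2 * #|{: V}|) * \det (1%:M - u *: Wsearch R adj M) =
  (1 - u) ^+ (r * #|{: V}| + #|M|) *
    \prod_k ((1 + u) ^+ 2 - 4 * u * lam k ^+ 2).
Proof.
move=> /andP[u0 u1] orth nz eig; rewrite -card_edges /Wsearch.
rewrite det_two_reflections ?Kmx_isometry ?Lmx_isometry //; first last.
- by apply/eqP => h; move: u0; rewrite h; lra.
- by rewrite lt_eqF.
by rewrite walk_mxE walk_mx_tr (@det_orthogonal_eigenbasis _ _ _ phi lam).
Qed.

End SearchWalk.

(** An eigenvalue 1 gives the factor [(1 + u)^2 - 4u = (1 - u)^2]. With half of the [n] modes of
    this kind and half of the vertices marked, the total exponent of [1 - u] is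
    [rn + n/2 + n - 2n = (r - 1/2) n]; the modes in [S] keep their own factors. *)
Lemma zeta_search (R : realType) (V : finType) (adj : rel V) (M S : {set V})
    (r : nat) (u : R) (phi : V -> V -> R) (lam : V -> R) :
  symmetric adj -> (0 < r)%N -> (forall x, deg adj x = r) ->
  (0 < #|V|)%N -> (2 * #|M|)%N = #|V| -> (2 * #|~: S|)%N = #|V| -> 0 < u < 1 ->
  (forall k l, k != l -> \sum_x phi k x * phi l x = 0) ->
  (forall k, \sum_x phi k x ^+ 2 != 0) ->
  (forall k x, \sum_y walk_entry R V adj M r x y * phi k y = lam k * phi k x) ->
  (forall k, k \notin S -> lam k = 1) ->
  (forall k, k \in S -> 0 < (1 + u) ^+ 2 - 4 * u * lam k ^+ 2) ->
  (zeta #|V| (Wsearch R adj M) u)^-1 =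
  expR ((r%:R - 2^-1) * ln (1 - u) +
        #|V|%:R^-1 * \sum_(k in S) ln ((1 + u) ^+ 2 - 4 * u * lam k ^+ 2)).
Proof.
move=> sym r0 degr V0 cM cS u01 orth nz eig lam1 pos.
have [u0 u1] := andP u01.
have w0 : 0 < 1 - u by lra.
have H := @det_search R V adj M r sym r0 degr u phi lam u01 orth nz eig.
set D := \det _ in H.
pose Q := \prod_(k in S) ((1 + u) ^+ 2 - 4 * u * lam k ^+ 2).
have Q0 : 0 < Q by apply: prodr_gt0.
have {}H : (1 - u) ^+ (2 * #|V|) * D = (1 - u) ^+ (r * #|V| + #|M| + #|V|) * Q.
  rewrite H (bigID (mem S)) /= -/Q [in RHS]exprD -mulrA [in RHS](mulrC _ Q).
  congr (_ * (_ * _)); rewrite -cS exprM -prodr_const.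
  by apply: eq_big => [k|k kS]; [rewrite inE|rewrite lam1 //; ring].
have D0 : 0 < D by rewrite -(pmulr_rgt0 _ (exprn_gt0 (2 * #|V|) w0)) H mulr_gt0 ?exprn_gt0.
have n0 : #|V|%:R != 0 :> R by rewrite pnatr_eq0 -lt0n.
have cM' : #|M|%:R = #|V|%:R / 2 :> R by rewrite -cM natrM; field.
have {}H := congr1 (@ln R) H.
rewrite /zeta -/D -powRN opprK /powR gt_eqF //; congr expR.
rewrite !lnM ?posrE ?exprn_gt0 // !lnXn // in H.
have -> : ln D = (r%:R - 2^-1) * #|V|%:R * ln (1 - u) + ln Q.
  apply: (addrI (ln (1 - u) *+ (2 * #|V|))); rewrite H.
  rewrite -![ln (1 - u) *+ _]mulr_natr !natrD !natrM cM'; by field.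
have -> : ln Q = \sum_(k in S) ln ((1 + u) ^+ 2 - 4 * u * lam k ^+ 2).
  (* Positivity is carried along the product because [lnM] needs it for every partial product. *)
  suff [] : 0 < Q /\ ln Q = \sum_(k in S) ln ((1 + u) ^+ 2 - 4 * u * lam k ^+ 2) by [].
  rewrite /Q; elim/big_rec2: _ => [|k y x kS [x0 <-]]; first by rewrite ln1.
  by split; [rewrite mulr_gt0 // pos|rewrite lnM // posrE pos].
by field.
Qed.

(** * The torus *)

Lemma val_ordS n (a : 'I_n) : val (ordS a) = if a.+1 == n then 0%N else a.+1.
Proof.
rewrite /=; case: eqP => [->|/eqP ne]; first by rewrite modnn.
by rewrite modn_small // ltn_neqAle ne ltn_ord.
Qed.

Lemma val_ord_pred n (a : 'I_n) : val (ord_pred a) = if val a == 0%N then n.-1 else a.-1.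
Proof.
have an := ltn_ord a; rewrite /=; case: eqP => [->|/eqP ne].
  by rewrite add0n modn_small // prednK // (leq_ltn_trans _ an).
rewrite -lt0n in ne; have -> : ((a + n).-1 = a.-1 + n)%N by lia.
by rewrite modnDr modn_small // (leq_ltn_trans _ an) // leq_pred.
Qed.

Section Torus.
Variables (d N : nat).
Hypothesis N2 : (2 <= N)%N.
Notation V := {ffun 'I_d -> 'I_(2 * N)}.
Implicit Types x y : V.

Definition set_coord x (i : 'I_d) (a : 'I_(2 * N)) : V :=
  [ffun j => if j == i then a else x j].

Lemma set_coord_eq x i a : set_coord x i a i = a.
Proof. by rewrite ffunE eqxx. Qed.

Lemma set_coord_neq x i j a : j != i -> set_coord x i a j = x j.
Proof. by move=> /negPf ji; rewrite ffunE ji. Qed.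

Lemma torus_adj_sym : symmetric (@torus_adj d N).
Proof.
move=> x y; apply: eq_existsb => i; rewrite orbC; congr (_ && _).
by apply: eq_forallb => j; rewrite (eq_sym (y j)).
Qed.

Definition neighbour x (p : 'I_d * bool) : V :=
  set_coord x p.1 (if p.2 then ordS (x p.1) else ord_pred (x p.1)).

(** With [N >= 2] the cycle has length at least 4, so a coordinate, its successor and its
    predecessor are distinct; hence the torus is [2d]-regular. *)
Lemma neighbour_inj x : injective (neighbour x).
Proof.
have h1 (a : 'I_(2 * N)) : ordS a != a.
  by rewrite -val_eqE val_ordS; have := ltn_ord a; case: ifP => /=; lia.
have h2 (a : 'I_(2 * N)) : ord_pred a != a.
  by rewrite -val_eqE val_ord_pred; have := ltn_ord a; case: ifP => /=; lia.
have h3 (a : 'I_(2 * N)) : ordS a != ord_pred a.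
  rewrite -val_eqE val_ordS val_ord_pred; have := ltn_ord a.
  by case: ifP => /=; case: ifP => /=; lia.
move=> [i b] [j c] /ffunP /(_ i); rewrite /neighbour /= set_coord_eq.
case: (eqVneq i j) => [<-|ij].
  rewrite set_coord_eq; case: b; case: c => // /eqP; last rewrite eq_sym; by rewrite (negPf (h3 _)).
by rewrite set_coord_neq //; case: b => /eqP; rewrite ?(negPf (h1 _)) ?(negPf (h2 _)).
Qed.

Lemma torus_adjP x y : reflect (exists p, y = neighbour x p) (torus_adj x y).
Proof.
apply: (iffP existsP) => [[i /andP[xy /forallP yx]]|[[i b] ->]].
  exists (i, val (y i) == (val (x i)).+1 %% (2 * N))%N; apply/ffunP => j.
  rewrite /neighbour /=; case: (eqVneq j i) => [->|ji]; last first.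
    by rewrite set_coord_neq //; have := yx j; rewrite ji => /eqP.
  rewrite set_coord_eq; case: ifP xy => [/eqP yi _|_ /=]; first exact: val_inj.
  by move=> /eqP xi; rewrite -(ordSK (y i)); congr ord_pred; apply: val_inj.
exists i; rewrite /neighbour /= set_coord_eq; apply/andP; split; last first.
  by apply/forallP => j; apply/implyP => ji; rewrite set_coord_neq.
case: b; first by rewrite eqxx.
by apply/orP; right; rewrite -[X in X == _]/(val (x i)) -{1}(ord_predK (x i)).
Qed.

Lemma sum_torus_adj (A : nmodType) x (g : V -> A) :
  \sum_(y | torus_adj x y) g y =
  \sum_(i < d) (g (set_coord x i (ordS (x i))) + g (set_coord x i (ord_pred (x i)))).
Proof.
transitivity (\sum_(y in [set neighbour x p | p : 'I_d * bool]%SET) g y).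
  by apply: eq_bigl => y; apply/torus_adjP/imsetP => [[p ->]|[p _ ->]]; exists p.
rewrite big_imset /=; last by move=> p q _ _ /neighbour_inj.
rewrite -(pair_bigA _ (fun i b => g (neighbour x (i, b)))) /=.
by apply: eq_bigr => i _; rewrite big_bool.
Qed.

Lemma deg_torus x : deg (@torus_adj d N) x = (2 * d)%N.
Proof.
rewrite degE -sum1_card.
have := @sum_torus_adj nat x (fun _ => 1%N).
rewrite [X in _ = X -> _]sum_nat_const card_ord => e.
rewrite (mulnC 2%N d) -[RHS]e.
exact: eq_bigl.
Qed.

Lemma card_torus : #|{: V}| = ((2 * N) ^ d)%N.
Proof. by rewrite card_ffun !card_ord. Qed.

(** The reversal [a |-> 2N - 1 - a] of one coordinate is an involution exchanging [M] and its
    complement. It serves both markings: it flips parity and swaps the two halves of the cycle. *)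
Lemma card_half (M : {set V}) (i : 'I_d) :
  (forall x, (set_coord x i (rev_ord (x i)) \in M) = (x \notin M)) ->
  ((2 * #|M|)%N = #|{: V}|) /\ ((2 * #|~: M|)%N = #|{: V}|).
Proof.
move=> hM; pose h x := set_coord x i (rev_ord (x i)).
have hK : involutive h.
  move=> x; apply/ffunP => j; rewrite /h; case: (eqVneq j i) => [->|ji].
    by rewrite !set_coord_eq rev_ordK.
  by rewrite !(set_coord_neq _ i j).
have e : #|~: M| = #|M|.
  rewrite -(card_imset _ (inv_inj hK)); apply: eq_card => x.
  apply/imsetP/idP => [[y]|xM]; first by rewrite inE -hM => yM ->.
  by exists (h x); rewrite ?hK // inE -hM -/(h _) hK.
by have := cardsC M; rewrite e addnn -mul2n.
Qed.

End Torus.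

Arguments set_coord {d N}.
Arguments neighbour {d N}.

(** * Case 1: marking by parity *)

Lemma odd_sum_set_coord d N (x : {ffun 'I_d -> 'I_(2 * N)}) i (a : 'I_(2 * N)) :
  odd a = ~~ odd (x i) ->
  odd (\sum_(j < d) val (set_coord x i a j))%N = ~~ odd (\sum_(j < d) val (x j))%N.
Proof.
move=> ha; rewrite (bigD1 i) //= [in RHS](bigD1 i) //= !oddD set_coord_eq ha addNb.
congr (~~ (_ (+) odd _)); apply: eq_bigr => j ji.
by rewrite set_coord_neq.
Qed.

(** A step flips the parity of the coordinate sum, also across the wrap since [2 * N] is even, so
    all neighbours of an unmarked vertex are marked and [T] is diagonal. Half of the eigenvalues are
    0, each contributing [2 ln (1 + u)]. *)
Lemma zeta_W1 (R : realType) (d N : nat) (u : R) :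
  (1 <= d)%N -> 0 < u < 1 -> (2 <= N)%N ->
  (zeta ((2 * N) ^ d) (W1 R d N) u)^-1 =
    expR ((2 * d%:R - 2^-1) * ln (1 - u) + ln (1 + u)).
Proof.
case: d => // d _ u01 N2; have /andP[u0 u1] := u01.
pose V := {ffun 'I_d.+1 -> 'I_(2 * N)}.
have revM (x : V) :
  (set_coord x ord_max (rev_ord (x ord_max)) \in M1 d.+1 N) = (x \notin M1 d.+1 N).
  rewrite !inE odd_sum_set_coord //= oddB; last exact: ltn_ord.
  by rewrite oddM.
have [c1 c2] := @card_half d.+1 N (M1 d.+1 N) ord_max revM.
have adjM (x y : V) : torus_adj x y -> (y \in M1 d.+1 N) = (x \notin M1 d.+1 N).
  move=> /torus_adjP[[i b] ->]; rewrite !inE /neighbour odd_sum_set_coord //=.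
  case: b; have := ltn_ord (x i).
    by rewrite -[nat_of_ord (ordS _)]/(val (ordS (x i))) val_ordS; case: ifP => /=; lia.
  by rewrite -[nat_of_ord (ord_pred _)]/(val (ord_pred (x i))) val_ord_pred; case: ifP => /=; lia.
have V0 : (0 < #|{: V}|)%N by rewrite card_torus expn_gt0 muln_gt0 /= (ltnW N2).
rewrite /W1 -card_torus.
(* The eigenbasis consists of delta functions, with eigenvalue 1 on [M1] and 0 on [S], the unmarked
   half. *)
rewrite (@zeta_search R V (@torus_adj d.+1 N) (M1 d.+1 N) (~: M1 d.+1 N) (2 * d.+1) u
  (fun k x => (k == x)%:R) (fun k => (k \in M1 d.+1 N)%:R)) //.
- rewrite natrM; congr (expR (_ + _)).
  rewrite (eq_bigr (fun _ => ln (1 + u) *+ 2)) => [|k]; last first.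
    by rewrite inE => /negPf ->; rewrite expr0n /= mulr0 subr0 lnXn //; lra.
  rewrite sumr_const -mulrnA -[_ *+ _]mulr_natr c2; field.
  by rewrite pnatr_eq0 -lt0n.
- exact: torus_adj_sym.
- exact: deg_torus.
- by rewrite finset.setCK.
- by move=> k l kl; rewrite big1 // => x _; case: (eqVneq k x) kl => [->|_] ne;
    rewrite ?mul0r // mul1r (eq_sym l) (negPf ne).
- move=> k; rewrite (bigD1 k) //= eqxx big1 ?addr0 ?expr1n ?oner_eq0 // => x /negPf xk.
  by rewrite eq_sym xk expr0n.
- move=> k x; rewrite (sum_pred1r _ _ _ _ k) => [|y /negPf yk]; last by rewrite eq_sym yk mulr0.
  rewrite eqxx mulr1 /walk_entry (eq_sym x); case: (boolP (x \in _)) => xM.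
    by case: eqVneq => [->|_]; rewrite ?xM ?mulr1 ?mulr0.
  case: ifP => [/andP[kM /adjM]|_]; first by rewrite xM (negPf kM).
  by case: eqVneq => [->|_]; rewrite ?(negPf xM) ?mul0r ?mulr0.
- by move=> k; rewrite inE negbK => ->.
- by move=> k; rewrite inE => /negPf ->; rewrite expr0n /= mulr0 subr0 exprn_gt0 //; lra.
Qed.

(** * Second-order recurrences of trigonometric sequences *)

Section Recurrences.
Variable R : realType.
Implicit Types (t c : R) (f g : nat -> R).

Lemma cos_rec t (x : nat) :
  cos (t * x.+2%:R) + cos (t * x%:R) = 2 * cos t * cos (t * x.+1%:R).
Proof.
have -> : t * x.+2%:R = t * x.+1%:R + t by rewrite -(natr1 x.+1); ring.
have -> : t * x%:R = t * x.+1%:R - t by rewrite -(natr1 x); ring.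
by rewrite cosB cosD; ring.
Qed.

Lemma sin_rec t (x : nat) :
  sin (t * x.+2%:R) + sin (t * x%:R) = 2 * cos t * sin (t * x.+1%:R).
Proof.
have -> : t * x.+2%:R = t * x.+1%:R + t by rewrite -(natr1 x.+1); ring.
have -> : t * x%:R = t * x.+1%:R - t by rewrite -(natr1 x); ring.
by rewrite sinB sinD; ring.
Qed.

(** The two boundary conditions make the sums of [f] and of its shifts by 1 and 2 equal to one [s];
    summing the recurrence gives [2 s = 2 c s]. *)
Lemma sum_periodic_rec (n : nat) f c :
  (forall x, f x.+2 + f x = 2 * c * f x.+1) -> f n = f 0%N -> f n.+1 = f 1%N ->
  c != 1 -> \sum_(x < n) f x = 0.
Proof.
move=> frec fn fn1 c1.
have sh g : g n = g 0%N -> \sum_(x < n) g x.+1 = \sum_(x < n) g x.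
  move=> gn; apply: (addrI (g 0%N)); rewrite -(big_ord_recl n (fun i => g i)) big_ord_recr /=.
  by rewrite gn addrC.
have e1 := sh f fn; have e2 := sh (fun x => f x.+1) fn1.
have : \sum_(x < n) (f x.+2 + f x) = 2 * c * \sum_(x < n) f x.+1.
  by rewrite mulr_sumr; apply: eq_bigr => x _.
rewrite big_split /= e2 e1; move: (\sum_(_ < _) _) => s h.
have : (1 - c) * s = 0 by rewrite mulrBl mul1r; lra.
by move/eqP; rewrite mulf_eq0 subr_eq0 eq_sym (negPf c1) => /eqP.
Qed.

(* The discrete Wronskian telescopes, as in Green's identity. *)
Lemma sum_dirichlet_rec (n : nat) f g (a b : R) :
  (forall x, f x.+2 + f x = 2 * a * f x.+1) ->
  (forall x, g x.+2 + g x = 2 * b * g x.+1) ->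
  f 0%N = 0 -> g 0%N = 0 -> f n.+1 = 0 -> g n.+1 = 0 -> a != b ->
  \sum_(x < n) f x.+1 * g x.+1 = 0.
Proof.
move=> hf hg f0 g0 fn gn ab.
pose W x := f x.+1 * g x - f x * g x.+1.
have e x : 2 * (a - b) * (f x.+1 * g x.+1) = W x.+1 - W x.
  have := hf x; have := hg x => hgx hfx.
  have -> : 2 * (a - b) * (f x.+1 * g x.+1) =
     (2 * a * f x.+1) * g x.+1 - f x.+1 * (2 * b * g x.+1) by ring.
  by rewrite -hgx -hfx /W; ring.
have : 2 * (a - b) * \sum_(x < n) f x.+1 * g x.+1 = W n - W 0%N.
  rewrite mulr_sumr -(telescope_sumr W (leq0n n)) big_mkord.
  by apply: eq_bigr => x _.
rewrite /W f0 g0 fn gn !(mul0r, mulr0) !subr0 => /eqP.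
by rewrite !mulf_eq0 pnatr_eq0 subr_eq0 (negPf ab) => /eqP.
Qed.

Lemma cos_neq1 t : 0 < t < 2 * pi -> cos t != 1.
Proof.
move=> /andP[t0 t1].
have s0 : 0 < sin (t / 2) by rewrite sin_gt0_pi //; apply/andP; split; lra.
have -> : t = t / 2 + t / 2 by field.
rewrite cosD -expr2 -expr2 cos2sin2; apply/eqP => h.
have : 0 < sin (t / 2) ^+ 2 by rewrite exprn_gt0.
lra.
Qed.

Lemma sin_mul_nat0 t (x : nat) : sin t = 0 -> sin (t * x%:R) = 0.
Proof.
move=> st; elim: x => [|x IH]; first by rewrite mulr0 sin0.
by rewrite -natr1 mulrDr mulr1 sinD IH st mul0r mulr0 addr0.
Qed.

End Recurrences.

(** * Hartley modes of the cycle and sine modes of the path *)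

Section Modes.
Variables (R : realType) (N : nat).
Hypothesis N0 : (0 < N)%N.

Let N0' : N%:R != 0 :> R. Proof. by rewrite pnatr_eq0 -lt0n. Qed.

(* Unlike the cosines alone, these are [2N] independent real modes of the cycle. *)
Definition hartley (k x : nat) : R :=
  cos (k%:R * pi / N%:R * x%:R) + sin (k%:R * pi / N%:R * x%:R).

Let periodE (k x : nat) :
  k%:R * pi / N%:R * (2 * N + x)%:R = k%:R * pi / N%:R * x%:R + (pi *+ 2) *+ k :> R.
Proof. by rewrite natrD natrM -[_ *+ k]mulr_natr -[_ *+ 2]mulr_natr; field. Qed.

Let cos_period (k x : nat) :
  cos (k%:R * pi / N%:R * (2 * N + x)%:R) = cos (k%:R * pi / N%:R * x%:R) :> R.
Proof. by rewrite periodE (periodicn (@cosD2pi R)). Qed.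

Let sin_period (k x : nat) :
  sin (k%:R * pi / N%:R * (2 * N + x)%:R) = sin (k%:R * pi / N%:R * x%:R) :> R.
Proof. by rewrite periodE (periodicn (@sinD2pi R)). Qed.

Lemma hartley_period k x : hartley k (2 * N + x) = hartley k x.
Proof. by rewrite /hartley cos_period sin_period. Qed.

Lemma hartley_rec k x :
  hartley k x.+2 + hartley k x = 2 * cos (k%:R * pi / N%:R) * hartley k x.+1.
Proof. by rewrite /hartley (mulrDr (2 * _)) -cos_rec -sin_rec; ring. Qed.

(** The product of two modes is a cosine at frequency [k - l] plus a sine at frequency [k + l], and
    each sums to zero over a period. *)
Lemma hartley_orth (k l : nat) : (k < 2 * N)%N -> (l < 2 * N)%N -> k != l ->
  \sum_(x < 2 * N) hartley k x * hartley l x = 0.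
Proof.
wlog lk : k l / (l < k)%N.
  move=> H kN lN kl; case: (ltnP l k) => lk; first exact: H.
  under eq_bigr do rewrite mulrC.
  by apply: H => //; rewrite 1?eq_sym // ltn_neqAle kl.
move=> kN lN kl.
have -> : \sum_(x < 2 * N) hartley k x * hartley l x =
  \sum_(x < 2 * N) cos ((k - l)%:R * pi / N%:R * x%:R) +
  \sum_(x < 2 * N) sin ((k + l)%:R * pi / N%:R * x%:R).
  rewrite -big_split /=; apply: eq_bigr => x _; rewrite /hartley.
  have -> : (k - l)%:R * pi / N%:R * x%:R =
     k%:R * pi / N%:R * x%:R - l%:R * pi / N%:R * x%:R :> R.
    by rewrite natrB ?(ltnW lk) //; ring.
  have -> : (k + l)%:R * pi / N%:R * x%:R =
     k%:R * pi / N%:R * x%:R + l%:R * pi / N%:R * x%:R :> R by rewrite natrD; ring.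
  by rewrite cosB sinD; ring.
rewrite (@sum_periodic_rec R (2 * N) (fun x => cos ((k - l)%:R * pi / N%:R * x%:R)) _
  (cos_rec R _)); first last.
- apply: cos_neq1; apply/andP; split.
    by rewrite divr_gt0 ?mulr_gt0 ?pi_gt0 ?ltr0n // subn_gt0.
  rewrite ltr_pdivrMr ?ltr0n // [ltRHS]mulrAC -natrM ltr_pM2r ?pi_gt0 // ltr_nat.
  by rewrite (leq_ltn_trans (leq_subr _ _)).
- by rewrite -addn1 cos_period.
- by rewrite -[(2 * N)%N]addn0 cos_period.
(* The recurrence argument fails when [k + l = 2N], but then every sine in the sum is zero. *)
rewrite add0r; case: (eqVneq (cos ((k + l)%:R * pi / N%:R : R)) 1) => [c1|c1].
  apply: big1 => x _; apply: sin_mul_nat0; apply/eqP.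
  by rewrite -sqrf_eq0 sin2cos2 c1 expr1n subrr.
apply: (@sum_periodic_rec R (2 * N) (fun x => sin ((k + l)%:R * pi / N%:R * x%:R)) _
  (sin_rec R _)) => //.
- by rewrite -[(2 * N)%N]addn0 sin_period.
- by rewrite -addn1 sin_period.
Qed.

(* Dirichlet sine modes of the path [N, 2N - 1] for [k < N], completed by the
   delta functions at [k - N] for [N <= k < 2N]. *)
Definition path_mode (k x : nat) : R :=
  if (k < N)%N then
    if (N <= x)%N then sin (k.+1%:R * pi / N.+1%:R * (x - N).+1%:R) else 0
  else (x + N == k)%N%:R.

Lemma sin_end (k : nat) : sin (k%:R * pi / N.+1%:R * N.+1%:R) = 0 :> R.
Proof.
have -> : k%:R * pi / N.+1%:R * N.+1%:R = pi * k%:R :> R.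
  by rewrite divfK ?pnatr_eq0 // mulrC.
by apply: sin_mul_nat0; rewrite sinpi.
Qed.

Lemma path_mode_orth (k l : nat) : (k < 2 * N)%N -> (l < 2 * N)%N -> k != l ->
  \sum_(x < 2 * N) path_mode k x * path_mode l x = 0.
Proof.
wlog lk : k l / (l < k)%N.
  move=> H kN lN kl; case: (ltnP l k) => lk; first exact: H.
  under eq_bigr do rewrite mulrC.
  by apply: H => //; rewrite 1?eq_sym // ltn_neqAle kl.
(* A delta mode sits at [k - N < N], where the sine modes vanish; two sine modes need the Wronskian
   argument. *)
move=> k2 l2 kl; case: (ltnP k N) => kN; last first.
  rewrite big1 // => x _; rewrite /path_mode ltnNge kN /=.
  case: (eqVneq (x + N)%N k) => [e|_]; last by rewrite mul0r.
  case: (ltnP l N) => lN; last by rewrite e (negPf kl) mulr0.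
  by rewrite leqNgt ifN ?mulr0 // negbK; move: lN k2 => /=; lia.
have lN := ltn_trans lk kN.
rewrite mul2n -addnn big_split_ord /= big1 ?add0r => [|x _]; last first.
  by rewrite /path_mode kN leqNgt ltn_ord mul0r.
(* The frequencies lie in [[0, pi]], where the cosine is injective. *)
have ne : cos (k.+1%:R * pi / N.+1%:R : R) != cos (l.+1%:R * pi / N.+1%:R).
  have inI (j : nat) : (j < N)%N -> (j.+1%:R * pi / N.+1%:R : R) \in `[0, pi]%R.
    move=> jN; rewrite in_itv /= divr_ge0 ?mulr_ge0 ?pi_ge0 ?ler0n //=.
    by rewrite ler_pdivrMr ?ltr0n // mulrC ler_pM2l ?pi_gt0 // ler_nat ltnW.
  apply/eqP => /(cos_inj (inI _ kN) (inI _ lN)) /divIf.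
  rewrite pnatr_eq0 => /(_ isT) /mulIf; rewrite gt_eqF ?pi_gt0 // => /(_ isT) /eqP.
  by rewrite eqr_nat eqSS (negPf kl).
rewrite -[RHS](@sum_dirichlet_rec R N _ _ _ _ (sin_rec R _) (sin_rec R _) _ _
  (sin_end k.+1) (sin_end l.+1) ne) ?mulr0 ?sin0 //.
by apply: eq_bigr => x _; rewrite /path_mode kN lN leq_addr addKn.
Qed.

Lemma hartley_norm k : \sum_(x < 2 * N) hartley k x ^+ 2 != 0.
Proof.
have N2 : (0 < 2 * N)%N by rewrite muln_gt0.
rewrite (bigD1 (Ordinal N2)) //= {1}/hartley mulr0 sin0 cos0 addr0 expr1n.
by rewrite gt_eqF // ltr_wpDr // sumr_ge0 // => x _; rewrite sqr_ge0.
Qed.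

Lemma path_mode_norm (k : nat) : (k < 2 * N)%N -> \sum_(x < 2 * N) path_mode k x ^+ 2 != 0.
Proof.
move=> k2; suff [x x0] : exists x : 'I_(2 * N), path_mode k x != 0.
  rewrite (bigD1 x) //= gt_eqF // ltr_wpDr //; first by rewrite sumr_ge0 // => y _; rewrite sqr_ge0.
  by rewrite exprn_even_gt0.
rewrite /path_mode; case: (ltnP k N) => kN; last first.
  have h : (k - N < 2 * N)%N by lia.
  by exists (Ordinal h); rewrite /= subnK // eqxx oner_eq0.
have h : (N < 2 * N)%N by lia.
exists (Ordinal h); rewrite /= leqnn subnn mulr1 gt_eqF // sin_gt0_pi //; apply/andP; split.
  by rewrite divr_gt0 ?mulr_gt0 ?pi_gt0 ?ltr0n.
by rewrite ltr_pdivrMr ?ltr0n // mulrC ltr_pM2l ?pi_gt0 // ltr_nat.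
Qed.

Lemma hartley_eig k (x : 'I_(2 * N)) :
  hartley k (ordS x) + hartley k (ord_pred x) = 2 * cos (k%:R * pi / N%:R) * hartley k x.
Proof.
have per0 : hartley k (2 * N) = hartley k 0 by rewrite -[(2 * N)%N]addn0 hartley_period.
have per1 : hartley k (2 * N).+1 = hartley k 1 by rewrite -addn1 hartley_period.
have -> : hartley k (ordS x) = hartley k x.+1.
  rewrite -[nat_of_ord _]/(val (ordS x)) val_ordS; case: eqP => // ->; exact: esym.
rewrite -[nat_of_ord (ord_pred x)]/(val (ord_pred x)) val_ord_pred /=; case: eqP => [->|/eqP].
  (* At [x = 0] the predecessor is [2N - 1]; periodicity moves the recurrence to the points
     [2N - 1], [2N], [2N + 1]. *)
  have n1 : (2 * N = (2 * N).-1.+1)%N by rewrite prednK // muln_gt0.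
  by rewrite -per0 -per1 [in hartley k (2 * N).+1]n1 [in RHS]n1 hartley_rec.
by rewrite -lt0n => x0; rewrite -{1 3}(prednK x0) hartley_rec.
Qed.

(** Both ends of the path border the marked half, where the mode is 0. These zeros agree with those
    of the sine at positions 0 and [N + 1], so the recurrence holds up to the ends. *)
Lemma path_mode_eig k (x : 'I_(2 * N)) : (k < N)%N -> (N <= x)%N ->
  path_mode k (ordS x) + path_mode k (ord_pred x) =
  2 * cos (k.+1%:R * pi / N.+1%:R) * path_mode k x.
Proof.
move=> kN Nx; pose s (j : nat) : R := sin (k.+1%:R * pi / N.+1%:R * j%:R).
have -> : path_mode k x = s (x - N).+1 by rewrite /path_mode kN Nx.
have -> : path_mode k (ordS x) = s (x - N).+2.
  rewrite /path_mode kN -[nat_of_ord _]/(val (ordS x)) val_ordS; case: eqP => [e|_].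
    rewrite leqn0 gtn_eqF // /s; have -> : ((x - N).+2 = N.+1)%N by lia.
    by rewrite sin_end.
  by rewrite (leqW Nx) subSn.
have -> : path_mode k (ord_pred x) = s (x - N)%N; last exact: sin_rec.
rewrite /path_mode kN -[nat_of_ord _]/(val (ord_pred x)) val_ord_pred /=.
have x0 : (0 < x)%N by rewrite (leq_trans N0).
rewrite gtn_eqF //; case: (ltngtP N x) Nx => // [Nx _|<- _].
  have -> : (N <= x.-1)%N by lia.
  by have -> : ((x.-1 - N).+1 = x - N)%N by lia.
have -> : (N <= N.-1)%N = false by lia.
by rewrite subnn /s mulr0 sin0.
Qed.

End Modes.

(** The worst case [|s| = d] gives [(1 + u)^2 - 4u]. The bound keeps the argument of the logarithm
    positive, uniformly in [s]. *)
Lemma quadratic_lower (R : realFieldType) (u s : R) (d : nat) :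
  (0 < d)%N -> 0 < u < 1 -> `|s| <= d%:R ->
  (1 - u) ^+ 2 <= (1 + u) ^+ 2 - 4 * u / (d%:R ^+ 2) * s ^+ 2.
Proof.
move=> d0 /andP[u0 u1] sd.
have dp : 0 < d%:R ^+ 2 :> R by rewrite exprn_gt0 // ltr0n.
have : s ^+ 2 <= d%:R ^+ 2 by rewrite -(real_normK (num_real s)) lerXn2r ?nnegrE ?ler0n.
rewrite -[leRHS]mul1r -(ler_pdivrMr _ _ dp) => h.
have -> : 4 * u / (d%:R ^+ 2) * s ^+ 2 = 4 * u * (s ^+ 2 / d%:R ^+ 2) by rewrite mulrAC -mulrA.
have : 4 * u * (s ^+ 2 / d%:R ^+ 2) <= 4 * u by rewrite ler_piMr //; lra.
lra.
Qed.

Lemma sum_split_last (A : nmodType) (d : nat) (a b : 'I_d -> A) :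
  \sum_(i < d | val i != d.-1) a i + \sum_(i < d | val i == d.-1) b i =
  \sum_(i < d) if val i == d.-1 then b i else a i.
Proof.
rewrite [RHS](bigID (fun i : 'I_d => val i == d.-1)) /= [LHS]addrC.
congr (_ + _); last by apply: eq_bigr => i /negPf ->.
by apply: eq_bigr => i ->.
Qed.

Lemma sum_cos_bound (R : realType) (d : nat) (a b : 'I_d -> R) :
  `|\sum_(i < d) if val i == d.-1 then cos (b i) else cos (a i)| <= d%:R.
Proof.
apply: (le_trans (ler_norm_sum _ _ _)).
have -> : d%:R = \sum_(i < d) 1 :> R by rewrite sumr_const card_ord.
by apply: ler_sum => i _; case: ifP => _; rewrite ler_norml cos_geN1 cos_le1.
Qed.

Lemma mem_M2 d N (x : {ffun 'I_d.+1 -> 'I_(2 * N)}) : (x \in M2 d.+1 N) = (x ord_max < N)%N.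
Proof.
rewrite inE; apply/forallP/idP => [/(_ ord_max)|h i]; first by rewrite eqxx.
by apply/implyP => /eqP e; have -> : i = ord_max by apply: val_inj.
Qed.

(** * Case 2: product modes on the torus *)

Section ProductModes.
Variables (R : realType) (d N : nat).
Hypothesis N2 : (2 <= N)%N.
Notation V := {ffun 'I_d.+1 -> 'I_(2 * N)}.
Implicit Types k x : V.

Let N0 : (0 < N)%N := ltnW N2.

Definition mode (i : 'I_d.+1) : nat -> nat -> R :=
  if val i == d then path_mode R N else hartley R N.

Definition torus_mode k x : R := \prod_i mode i (k i) (x i).

(** Half the adjacency eigenvalue of the one-dimensional factor; path frequencies start at 1, hence
    [a.+1]. *)
Definition mode_cos (i : 'I_d.+1) (a : nat) : R :=
  if val i == d then cos (a.+1%:R * pi / N.+1%:R) else cos (a%:R * pi / N%:R).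

(** Modes with last index at least [N] live on marked vertices, where [T] is the identity. *)
Definition torus_eigenvalue k : R :=
  if (k ord_max < N)%N then (\sum_i mode_cos i (k i)) / d.+1%:R else 1.

(** The inner product factors over coordinates, and a coordinate where [k] and [l] differ gives a
    zero factor. *)
Lemma torus_mode_orth k l : k != l -> \sum_x torus_mode k x * torus_mode l x = 0.
Proof.
move=> kl; under eq_bigr do rewrite -big_split /=.
rewrite -(bigA_distr_bigA (fun i (a : 'I_(2 * N)) => mode i (k i) a * mode i (l i) a)).
have [i kli] : exists i, k i != l i.
  by apply/existsP; apply: contra_neqT kl; rewrite negb_exists => /forallP h;
     apply/ffunP => i; apply/eqP; rewrite -[_ == _]negbK.
rewrite (bigD1 i) //= /mode; case: ifP => _.
  by rewrite path_mode_orth ?mul0r.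
by rewrite hartley_orth ?mul0r.
Qed.

Lemma torus_mode_norm k : \sum_x torus_mode k x ^+ 2 != 0.
Proof.
under eq_bigr do rewrite -prodrXl.
rewrite -(bigA_distr_bigA (fun i (a : 'I_(2 * N)) => mode i (k i) a ^+ 2)).
apply/prodf_neq0 => i _; rewrite /mode; case: ifP => _; first exact: path_mode_norm.
exact: hartley_norm.
Qed.

Lemma torus_mode_set_coord k x i a :
  torus_mode k (set_coord x i a) =
  mode i (k i) a * \prod_(j | j != i) mode j (k j) (x j).
Proof.
rewrite /torus_mode (bigD1 i) //= set_coord_eq; congr (_ * _).
by apply: eq_bigr => j ji; rewrite set_coord_neq.
Qed.

(** Supports are opposite to indices: sine modes, of last index below [N], live on the unmarked
    half, and delta modes on the marked half. *)
Lemma torus_mode0 k x : (k ord_max < N)%N = (x ord_max < N)%N -> torus_mode k x = 0.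
Proof.
move=> kx; rewrite /torus_mode (bigD1 ord_max) //= /mode eqxx /path_mode kx.
case: (ltnP (x ord_max) N) => xN; first by rewrite mul0r.
by rewrite gtn_eqF ?mul0r //; have := ltn_ord (k ord_max); lia.
Qed.

Lemma torus_mode_eig k x :
  \sum_y walk_entry R V (@torus_adj d.+1 N) (M2 d.+1 N) (2 * d.+1) x y * torus_mode k y =
  torus_eigenvalue k * torus_mode k x.
Proof.
rewrite /walk_entry mem_M2 /torus_eigenvalue.
case: (ltnP (x ord_max) N) => xN.
  rewrite (sum_pred1r _ _ _ _ x) => [|y yx]; last by rewrite eq_sym (negPf yx) mul0r.
  rewrite eqxx mul1r; case: (ltnP (k ord_max) N) => kN; last by rewrite mul1r.
  by rewrite torus_mode0 ?mulr0 // kN xN.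
case: (ltnP (k ord_max) N) => kN; last first.
  rewrite mul1r [RHS]torus_mode0 ?(leq_gtF kN) ?(leq_gtF xN) // big1 // => y _.
  rewrite mem_M2; case: (ltnP (y ord_max) N) => yN; first by rewrite mul0r.
  by rewrite torus_mode0 ?mulr0 // (leq_gtF kN) (leq_gtF yN).
transitivity ((2 * d.+1)%:R^-1 * \sum_(y | torus_adj x y) torus_mode k y).
  rewrite mulr_sumr [RHS]big_mkcond; apply: eq_bigr => y _; rewrite mem_M2.
  case: (ltnP (y ord_max) N) => yN; last by case: (torus_adj x y); rewrite ?mul0r.
  by rewrite torus_mode0 ?kN ?yN // !mulr0 if_same.
rewrite sum_torus_adj // (eq_bigr (fun i => 2 * mode_cos i (k i) * torus_mode k x)) => [|i _].
  rewrite -mulr_suml -mulr_sumr natrM; field.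
  by rewrite addrC natr1 pnatr_eq0.
rewrite !torus_mode_set_coord -mulrDl.
have -> : mode i (k i) (ordS (x i)) + mode i (k i) (ord_pred (x i)) =
    2 * mode_cos i (k i) * mode i (k i) (x i).
  rewrite /mode /mode_cos; case: eqP => [e|_]; last exact: hartley_eig.
  have -> : i = ord_max by apply: val_inj.
  exact: path_mode_eig.
by rewrite -mulrA; congr (_ * _); rewrite /torus_mode [RHS](bigD1 i).
Qed.

End ProductModes.

Lemma zeta_W2 (R : realType) (d N : nat) (u : R) :
  (1 <= d)%N -> 0 < u < 1 -> (2 <= N)%N ->
  (zeta ((2 * N) ^ d) (W2 R d N) u)^-1 =
  expR ((2 * d%:R - 2^-1) * ln (1 - u) +
    ((2 * N) ^ d)%:R^-1 *
      \sum_(k : {ffun 'I_d -> 'I_(2 * N)} |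
              [forall i : 'I_d, (val i == d.-1) ==> (val (k i) < N)%N])
        ln ((1 + u) ^+ 2 - 4 * u / (d%:R ^+ 2) *
             (\sum_(i < d | val i != d.-1) cos ((val (k i))%:R * pi / N%:R)
              + \sum_(i < d | val i == d.-1)
                  cos ((val (k i)).+1%:R * pi / N.+1%:R)) ^+ 2)).
Proof.
case: d => // d _ u01 N2; pose V := {ffun 'I_d.+1 -> 'I_(2 * N)}.
have revM (x : V) :
  (set_coord x ord_max (rev_ord (x ord_max)) \in M2 d.+1 N) = (x \notin M2 d.+1 N).
  by rewrite !mem_M2 set_coord_eq /=; have := ltn_ord (x ord_max); lia.
have [c1 c2] := @card_half d.+1 N (M2 d.+1 N) ord_max revM.
have V0 : (0 < #|{: V}|)%N by rewrite card_torus expn_gt0 muln_gt0 /= (ltnW N2).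
have lamE (k : V) : k \in M2 d.+1 N ->
   4 * u * torus_eigenvalue R d N k ^+ 2 = 4 * u / (d.+1%:R ^+ 2) *
             (\sum_(i < d.+1 | val i != d) cos ((val (k i))%:R * pi / N%:R)
              + \sum_(i < d.+1 | val i == d)
                  cos ((val (k i)).+1%:R * pi / N.+1%:R)) ^+ 2.
  rewrite mem_M2 /torus_eigenvalue => ->; rewrite (@sum_split_last R d.+1) exprMn exprVn.
  by rewrite mulrA mulrAC.
rewrite /W2 -card_torus.
(* [M2] appears twice: as the set of marked vertices, and as the set [S] of indices of the sine
   modes. *)
rewrite (@zeta_search R V (@torus_adj d.+1 N) (M2 d.+1 N) (M2 d.+1 N) (2 * d.+1) u
  (torus_mode R d N) (torus_eigenvalue R d N)) //.
- rewrite natrM; congr (expR (_ + _ * _)).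
  apply: eq_big => [k|k kM]; first by rewrite inE.
  by rewrite lamE.
- exact: torus_adj_sym.
- exact: deg_torus.
- exact: torus_mode_orth.
- exact: torus_mode_norm.
- exact: torus_mode_eig.
- by move=> k; rewrite mem_M2 /torus_eigenvalue => /negPf ->.
- move=> k kM; rewrite lamE //; have /andP[u0 u1] := u01.
  apply: (@lt_le_trans _ _ ((1 - u) ^+ 2)); first by rewrite exprn_gt0 //; lra.
  apply: quadratic_lower => //; rewrite (@sum_split_last R d.+1); exact: sum_cos_bound.
Qed.

(** * Quadrature of Lipschitz functions *)

Section LipschitzIntegral.
Variables (R : realType) (C : R).
Hypothesis C0 : 0 <= C.
Local Notation mu := (@lebesgue_measure R).
Implicit Types (f g : R -> R) (a b e : R).

Definition lip f := forall x y, `|f x - f y| <= C * `|x - y|.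

Lemma lip_continuous f : lip f -> continuous f.
Proof.
move=> fC x; apply/cvgrPdist_le => e e0.
have C1 : 0 < C + 1 by rewrite ltr_wpDl.
have eC : 0 < e / (C + 1) by rewrite divr_gt0.
near=> y; apply: (le_trans (fC x y)).
have h : `|x - y| <= e / (C + 1) by near: y; apply: (@cvgr_dist_le _ _ _ _ _ id x).
apply: (@le_trans _ _ ((C + 1) * `|x - y|)); first by rewrite ler_wpM2r // lerDl.
by rewrite mulrC -ler_pdivlMr.
Unshelve. all: by end_near.
Qed.

Lemma lip_integrable f a b : lip f -> mu.-integrable `[a, b[ (EFin \o f).
Proof.
move=> fC; have Icc : mu.-integrable `[a, b] (EFin \o f).
  apply: continuous_compact_integrable; first exact: segment_compact.
  exact/continuous_subspaceT/lip_continuous.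
apply: (integrableS _ _ _ Icc) => //.
by apply: subset_itvl; rewrite bnd_simp.
Qed.

Lemma lip_cst c : lip (fun _ => c).
Proof. by move=> x y; rewrite subrr normr0 mulr_ge0. Qed.

Lemma Rintegral_co_cst a b c : a <= b -> \int[mu]_(x in `[a, b[) c = c * (b - a).
Proof.
move=> ab; rewrite Rintegral_cst; last exact: measurable_itv.
rewrite /= lebesgue_measure_itv /= lte_fin.
by case: (ltgtP a b) ab => // -> _; rewrite subrr.
Qed.

Lemma Rintegral_dist f g a b e : lip f -> lip g -> a <= b ->
  (forall t, a <= t < b -> `|f t - g t| <= e) ->
  `|\int[mu]_(x in `[a, b[) f x - \int[mu]_(x in `[a, b[) g x| <= e * (b - a).
Proof.
move=> fC gC ab fg.
have If := lip_integrable f a b fC; have Ig := lip_integrable g a b gC.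
have Ic := lip_integrable _ a b (lip_cst e).
have Ih : mu.-integrable `[a, b[ (EFin \o (fun x => g x + e)).
  by apply: lip_integrable => x y; rewrite opprD addrACA subrr addr0.
have Ih2 : mu.-integrable `[a, b[ (EFin \o (fun x => f x + e)).
  by apply: lip_integrable => x y; rewrite opprD addrACA subrr addr0.
rewrite -(Rintegral_co_cst a b e ab) ler_distl lerBlDr -!RintegralD //.
apply/andP; split; apply: le_Rintegral => // x /=; rewrite in_itv /= => /fg.
all: by rewrite ler_distl => /andP[h1 h2]; lra.
Qed.

Lemma Rintegral_left_point f a b : lip f -> a <= b ->
  `|\int[mu]_(x in `[a, b[) f x - f a * (b - a)| <= C * (b - a) ^+ 2.
Proof.
move=> fC ab; rewrite -(Rintegral_co_cst a b (f a) ab) expr2 mulrA.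
apply: Rintegral_dist => // [|t /andP[at_ tb]]; first exact: lip_cst.
by apply: (le_trans (fC _ _)); rewrite ler_wpM2l // ger0_norm; lra.
Qed.

Lemma Rintegral_split f h (n : nat) : lip f -> 0 <= h ->
  \int[mu]_(x in `[0, n%:R * h[) f x =
  \sum_(k < n) \int[mu]_(x in `[k%:R * h, k.+1%:R * h[) f x.
Proof.
move=> fC h0; elim: n => [|n IH].
  by rewrite big_ord0 mul0r set_itvco0 Rintegral_set0.
have le1 : 0 <= n%:R * h by rewrite mulr_ge0.
have le2 : n%:R * h <= n.+1%:R * h by rewrite ler_wpM2r // ler_nat.
have E : `[0, n.+1%:R * h[%classic = `[0, n%:R * h[ `|` `[n%:R * h, n.+1%:R * h[.
  by apply: itv_bndbnd_setU; rewrite bnd_simp.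
rewrite big_ord_recr -IH E Rintegral_setU //.
  by rewrite -E; exact: lip_integrable.
apply/disj_setPS => x [] /=; rewrite !in_itv /= => /andP[_ h1] /andP[h2 _]; lra.
Qed.

(** One layer of [torus_int], to which it is convertible. *)
Definition mean f : R := (2 * pi)^-1 * \int[mu]_(x in `[0, 2 * pi[) f x.

Let pi2 : 0 < 2 * pi :> R. Proof. by rewrite mulr_gt0 ?pi_gt0. Qed.

Lemma mean_dist f g e : lip f -> lip g -> (forall t, `|f t - g t| <= e) ->
  `|mean f - mean g| <= e.
Proof.
move=> fC gC fg; rewrite /mean -mulrBr normrM gtr0_norm ?invr_gt0 //.
rewrite mulrC ler_pdivrMr //; have := Rintegral_dist f g 0 (2 * pi) e fC gC (ltW pi2).
by rewrite subr0; apply => t _.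
Qed.

Lemma mean_bound f e : lip f -> (forall t, `|f t| <= e) -> `|mean f| <= e.
Proof.
move=> fC fe; have -> : mean f = mean f - mean (fun _ => 0).
  by rewrite /mean (Rintegral_co_cst _ _ _ (ltW pi2)) mul0r mulr0 subr0.
by apply: mean_dist => // [|t]; [exact: lip_cst|rewrite subr0].
Qed.

(** Left-endpoint rule with [n] cells of width [h = 2 pi / n]: each cell errs by at most [C h^2],
    and [n C h^2 / (2 pi) = 2 pi C / n]. *)
Lemma mean_riemann f (n : nat) : lip f -> (0 < n)%N ->
  `|n%:R^-1 * \sum_(k < n) f (k%:R * (2 * pi / n%:R)) - mean f| <= 2 * pi * C / n%:R.
Proof.
move=> fC n0; have n0' : 0 < n%:R :> R by rewrite ltr0n.
have nn0 : n%:R != 0 :> R by rewrite gt_eqF.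
have pn0 : pi != 0 :> R by rewrite gt_eqF ?pi_gt0.
set h := 2 * pi / n%:R; have h0 : 0 <= h by rewrite divr_ge0 // ltW.
have E : 2 * pi = n%:R * h by rewrite /h [RHS]mulrC divfK // gt_eqF.
rewrite /mean {2}E Rintegral_split // -normrN opprB.
have -> : n%:R^-1 * \sum_(k < n) f (k%:R * h) =
  (2 * pi)^-1 * \sum_(k < n) f (k%:R * h) * (k.+1%:R * h - k%:R * h).
  rewrite mulr_sumr [in RHS]mulr_sumr; apply: eq_bigr => k _.
  have -> : k.+1%:R * h - k%:R * h = h by rewrite -natr1; ring.
  by rewrite /h; move: pi pn0 => p p0; field; rewrite nn0 p0.
rewrite -mulrBr -sumrB normrM gtr0_norm ?invr_gt0 //.
apply: (@le_trans _ _ ((2 * pi)^-1 * \sum_(k < n) C * h ^+ 2)).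
  rewrite ler_wpM2l ?invr_ge0 ?(ltW pi2) //; apply: (le_trans (ler_norm_sum _ _ _)).
  apply: ler_sum => k _.
  have hE : k.+1%:R * h - k%:R * h = h by rewrite -natr1; ring.
  have := Rintegral_left_point f (k%:R * h) (k.+1%:R * h) fC.
  by rewrite !hE; apply; rewrite ler_wpM2r // ler_nat.
rewrite sumr_const card_ord -[_ *+ n]mulr_natr {1}E.
rewrite le_eqVlt; apply/orP; left; apply/eqP; rewrite /h; clear -nn0 pn0.
by move: pi pn0 => p p0; field; rewrite nn0 p0.
Qed.

End LipschitzIntegral.

(** * Iterated integrals and product quadrature *)

Definition ffun_cons (n : nat) (T : Type) (a : T) (k : {ffun 'I_n -> T}) :
    {ffun 'I_n.+1 -> T} :=
  [ffun i => if unlift ord0 i is Some j then k j else a].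

Lemma ffun_cons0 n T a (k : {ffun 'I_n -> T}) : ffun_cons n T a k ord0 = a.
Proof. by rewrite ffunE unlift_none. Qed.

Lemma ffun_consS n T a (k : {ffun 'I_n -> T}) j : ffun_cons n T a k (lift ord0 j) = k j.
Proof. by rewrite ffunE liftK. Qed.

Lemma sum_ffun_cons (A : nmodType) (n : nat) (T : finType) (G : {ffun 'I_n.+1 -> T} -> A) :
  \sum_k G k = \sum_a \sum_k G (ffun_cons n T a k).
Proof.
rewrite pair_bigA /=.
apply: (reindex (fun p : T * {ffun 'I_n -> T} => ffun_cons n T p.1 p.2)).
apply: onW_bij.
exists (fun k : {ffun 'I_n.+1 -> T} =>
    (k ord0, [ffun j : 'I_n => k (lift ord0 j)] : {ffun 'I_n -> T})) => [[a k]|k] /=.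
  by rewrite ffun_cons0; congr (_, _); apply/ffunP => j; rewrite ffunE ffun_consS.
apply/ffunP => i; case: (unliftP ord0 i) => [j|] ->; last by rewrite ffun_cons0.
by rewrite ffun_consS ffunE.
Qed.

Lemma sum_ffun0 (A : nmodType) (T : finType) (G : {ffun 'I_0 -> T} -> A) (k0 : {ffun 'I_0 -> T}) :
  \sum_k G k = G k0.
Proof.
rewrite (bigD1 k0) //= big1 ?addr0 // => k /eqP []; apply/ffunP; by case.
Qed.

Section TorusIntegral.
Variables (R : realType) (C : R).
Hypothesis C0 : 0 <= C.

(** Lipschitz for the l1 distance of the first [n] entries, missing ones read as 0. Fixing the head
    keeps the constant [C], so one constant serves every level of the integral. *)
Definition lipn (n : nat) (f : seq R -> R) :=
  forall s s', `|f s - f s'| <= C * \sum_(i < n) `|nth 0 s i - nth 0 s' i|.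

Lemma lipn_cons n f t : lipn n.+1 f -> lipn n (fun s => f (t :: s)).
Proof.
by move=> fC s s'; apply: (le_trans (fC _ _)); rewrite big_ord_recl /= subrr normr0 add0r.
Qed.

Lemma lipn_head n f t t' s : lipn n.+1 f -> `|f (t :: s) - f (t' :: s)| <= C * `|t - t'|.
Proof.
move=> fC; apply: (le_trans (fC _ _)); rewrite big_ord_recl /= big1 ?addr0 // => i _.
by rewrite subrr normr0.
Qed.

Lemma torus_int_dist n f g e : lipn n f -> lipn n g ->
  (forall s, `|f s - g s| <= e) -> `|torus_int n f - torus_int n g| <= e.
Proof.
elim: n f g e => [|n IH] f g e fC gC fg; first exact: fg.
(* Two sections of [h] differ by at most [C * |t - t'|], so the induction hypothesis itself makes
   the inner integral Lipschitz. *)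
have lipI h : lipn n.+1 h -> lip R C (fun t => torus_int n (fun s => h (t :: s))).
  move=> hC t t'; apply: IH; [exact: lipn_cons|exact: lipn_cons|move=> s].
  exact: (lipn_head n).
apply: (mean_dist R C C0); [exact: lipI|exact: lipI|move=> t].
by apply: IH => [||s]; [exact: lipn_cons|exact: lipn_cons|exact: fg].
Qed.

Lemma torus_int_lip n f : lipn n.+1 f -> lip R C (fun t => torus_int n (fun s => f (t :: s))).
Proof.
move=> fC t t'; apply: torus_int_dist; [exact: lipn_cons|exact: lipn_cons|move=> s].
exact: (lipn_head n).
Qed.

Lemma torus_int_bound n f B : lipn n f -> (forall s, `|f s| <= B) -> `|torus_int n f| <= B.
Proof.
elim: n f => [|n IH] f fC fB; first exact: fB.
apply: (mean_bound R C C0); first exact: torus_int_lip.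
by move=> t; apply: IH; [exact: lipn_cons|move=> s; exact: fB].
Qed.

(** One-dimensional errors add up: the weights are nonnegative of sum 1, so averaging over the head
    does not amplify the error of the remaining coordinates. The point [a0] supplies the empty
    function in dimension 0. *)
Lemma torus_quadrature (T : finType) (B e : R) (n : nat) (w q : 'I_n -> T -> R)
    (f : seq R -> R) (a0 : T) :
  (forall i a, 0 <= w i a) -> (forall i, \sum_a w i a = 1) ->
  (forall i g, lip R C g -> (forall t, `|g t| <= B) ->
     `|\sum_a w i a * g (q i a) - mean R g| <= e) ->
  lipn n f -> (forall s, `|f s| <= B) ->
  `|\sum_(k : {ffun 'I_n -> T})
       (\prod_i w i (k i)) * f [seq q i (k i) | i <- enum 'I_n] - torus_int n f|
  <= n%:R * e.
Proof.
elim: n w q f => [|n IH] w q f w0 w1 we fC fB.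
  rewrite (sum_ffun0 _ _ _ [ffun=> a0]) big_ord0 mul1r mul0r.
  have -> : enum 'I_0 = [::] by apply: size0nil; rewrite size_enum_ord.
  by rewrite /= subrr normr0.
pose I t := torus_int n (fun s => f (t :: s)).
pose w' (i : 'I_n) := w (lift ord0 i); pose q' (i : 'I_n) := q (lift ord0 i).
pose S t := \sum_(k : {ffun 'I_n -> T})
       (\prod_i w' i (k i)) * f (t :: [seq q' i (k i) | i <- enum 'I_n]).
have SI t : `|S t - I t| <= n%:R * e.
  exact: (IH w' q' (fun s => f (t :: s)) (fun i => w0 _) (fun i => w1 _)
    (fun i => we _) (lipn_cons _ _ t fC) (fun s => fB _)).
have -> : \sum_(k : {ffun 'I_n.+1 -> T})
       (\prod_i w i (k i)) * f [seq q i (k i) | i <- enum 'I_n.+1] =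
    \sum_a w ord0 a * S (q ord0 a).
  rewrite sum_ffun_cons; apply: eq_bigr => a _; rewrite mulr_sumr.
  apply: eq_bigr => k _; rewrite big_ord_recl ffun_cons0 -mulrA; congr (_ * (_ * f _)).
    by apply: eq_bigr => i _; rewrite ffun_consS.
  rewrite enum_ordSl /= ffun_cons0 -map_comp; congr (_ :: _).
  by apply: eq_map => i /=; rewrite ffun_consS.
rewrite -[torus_int n.+1 f]/(mean R I).
have -> : \sum_a w ord0 a * S (q ord0 a) - mean R I =
   \sum_a w ord0 a * (S (q ord0 a) - I (q ord0 a)) +
   (\sum_a w ord0 a * I (q ord0 a) - mean R I).
  by rewrite addrA -big_split /=; congr (_ - _); apply: eq_bigr => a _; rewrite -mulrDr subrK.
rewrite -natr1 mulrDl mul1r; apply: (le_trans (ler_normD _ _)); apply: lerD.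
  apply: (le_trans (ler_norm_sum _ _ _)).
  apply: (@le_trans _ _ (\sum_a w ord0 a * (n%:R * e))).
    by apply: ler_sum => a _; rewrite normrM ger0_norm // ler_wpM2l.
  by rewrite -mulr_suml w1 mul1r.
apply: we; first exact: torus_int_lip.
by move=> t; apply: torus_int_bound; [exact: lipn_cons|move=> s; exact: fB].
Qed.

End TorusIntegral.

(** * Quadrature nodes of the cycle and of the path *)

Section Nodes.
Variables (R : realType) (C B : R) (N : nat).
Hypotheses (C0 : 0 <= C) (N0 : (0 < N)%N).

Let N0' : 0 < N%:R :> R. Proof. by rewrite ltr0n. Qed.

(** These are the [2N] left endpoints on [[0, 2 pi)]; the term [2 * B] gives the same error bound as
    [half_nodes]. *)
Lemma full_nodes (g : R -> R) : lip R C g -> (forall t, `|g t| <= B) ->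
  `|\sum_(a < 2 * N) (2 * N)%:R^-1 * g (a%:R * pi / N%:R) - mean R g| <=
  (2 * pi * C + 2 * B) / N%:R.
Proof.
move=> gC gB; have B0 : 0 <= B by apply: le_trans (gB 0).
have N20 : (0 < 2 * N)%N by rewrite muln_gt0.
have -> : \sum_(a < 2 * N) (2 * N)%:R^-1 * g (a%:R * pi / N%:R) =
   (2 * N)%:R^-1 * \sum_(a < 2 * N) g (a%:R * (2 * pi / (2 * N)%:R)).
  rewrite mulr_sumr; apply: eq_bigr => a _; congr (_ * g _).
  by rewrite natrM -mulf_div divff // mul1r mulrA.
apply: (le_trans (mean_riemann R C C0 g (2 * N) gC N20)).
have P0 : 0 <= 2 * pi * C by rewrite !mulr_ge0 ?pi_ge0.
apply: (@le_trans _ _ ((2 * pi * C) / N%:R)).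
  rewrite ler_wpM2l // lef_pV2 ?posrE ?ltr0n // ler_nat; lia.
by rewrite ler_wpM2r ?invr_ge0 ?(ltW N0') // lerDl mulr_ge0.
Qed.

(** The doubled path angles are the [N + 1] equidistant nodes of [[0, 2 pi)] with 0 left out, and
    the weight is [1/N] instead of [1/(N + 1)]. Both changes together cost [(A - g 0) / N], at most
    [2B / N]. *)
Lemma half_nodes (g : R -> R) : lip R C g -> (forall t, `|g t| <= B) ->
  `|\sum_(a < 2 * N) (if (a < N)%N then N%:R^-1 else 0) *
      g (2 * (a.+1%:R * pi / N.+1%:R)) - mean R g| <=
  (2 * pi * C + 2 * B) / N%:R.
Proof.
move=> gC gB; have B0 : 0 <= B by apply: le_trans (gB 0).
have P0 : 0 <= 2 * pi * C by rewrite !mulr_ge0 ?pi_ge0.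
pose A := N.+1%:R^-1 * \sum_(a < N.+1) g (a%:R * (2 * pi / N.+1%:R)).
have hA : `|A - mean R g| <= 2 * pi * C / N%:R.
  apply: (le_trans (mean_riemann R C C0 g N.+1 gC (ltn0Sn N))).
  by rewrite ler_wpM2l // lef_pV2 ?posrE ?ltr0n // ler_nat.
have AB : `|A| <= B.
  rewrite /A normrM ger0_norm ?invr_ge0 // mulrC ler_pdivrMr ?ltr0n //.
  apply: (le_trans (ler_norm_sum _ _ _)).
  apply: (@le_trans _ _ (\sum_(a < N.+1) B)); first by apply: ler_sum => a _.
  by rewrite sumr_const card_ord mulr_natr.
have -> : \sum_(a < 2 * N) (if (a < N)%N then N%:R^-1 else 0) *
      g (2 * (a.+1%:R * pi / N.+1%:R)) = A + (A - g 0) / N%:R.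
  have E : \sum_(a < N) g (2 * (a.+1%:R * pi / N.+1%:R)) = N.+1%:R * A - g 0.
    rewrite /A mulVKf ?pnatr_eq0 // big_ord_recl mul0r addrAC subrr add0r.
    by apply: eq_bigr => a _; congr g; rewrite /= /bump /=; ring.
  rewrite mul2n -addnn big_split_ord /= [X in _ + X]big1 ?addr0 => [|a _]; last first.
    by rewrite ltnNge leq_addr mul0r.
  under eq_bigr do rewrite ltn_ord.
  rewrite -mulr_sumr E -natr1; field.
  by rewrite gt_eqF.
rewrite addrAC [leRHS]mulrDl; apply: (le_trans (ler_normD _ _)); apply: lerD => //.
rewrite normrM [`|N%:R^-1|]ger0_norm ?invr_ge0 ?(ltW N0') // ler_wpM2r ?invr_ge0 ?(ltW N0') //.
by apply: (le_trans (ler_normB _ _)); have := gB 0; lra.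
Qed.

End Nodes.

(** * Lipschitz and uniform bounds for the logarithmic integrand *)

Lemma cos_lip (R : realType) (x y : R) : `|cos x - cos y| <= `|x - y|.
Proof.
wlog xy : x y / y <= x.
  by move=> H; case: (leP y x) => [|/ltW] h; [exact: H|rewrite distrC (distrC x); exact: H].
have [|c _ ->] := @MVT_segment R cos (fun z => - sin z) y x xy (fun z _ => is_derive_cos z).
  exact/continuous_subspaceT/continuous_cos.
by rewrite normrM normrN ler_piMl // sin_max.
Qed.

Lemma ln_lip (R : realType) (m x y : R) : 0 < m -> m <= x -> m <= y ->
  `|ln x - ln y| <= `|x - y| / m.
Proof.
move=> m0; wlog xy : x y / y <= x.
  move=> H mx my; case: (leP y x) => [|/ltW] h; first exact: H.
  by rewrite distrC (distrC x); exact: H.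
move=> mx my; have y0 := lt_le_trans m0 my; have x0 := lt_le_trans m0 mx.
have lxy : ln y <= ln x by rewrite ler_ln ?posrE.
rewrite !ger0_norm ?subr_ge0 // -ln_div ?posrE //.
have -> : x / y = 1 + (x - y) / y by field; rewrite gt_eqF.
apply: (@le_trans _ _ ((x - y) / y)).
  apply: le_ln1Dx; apply: (@lt_le_trans _ _ 0); first by rewrite ltrN10.
  by rewrite divr_ge0 ?subr_ge0 // ltW.
by rewrite ler_wpM2l ?subr_ge0 // lef_pV2 ?posrE.
Qed.

Section Integrand.
Variables (R : realType) (d : nat) (u : R).
Hypotheses (d0 : (0 < d)%N) (u01 : 0 < u < 1).

Definition angle_sum (th : seq R) : R :=
  \sum_(i < d | val i != d.-1) cos (nth 0 th i) + cos (nth 0 th d.-1 / 2).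

Definition log_density (th : seq R) : R :=
  ln ((1 + u) ^+ 2 - 4 * u / (d%:R ^+ 2) * angle_sum th ^+ 2).

Lemma angle_sumE th : angle_sum th =
  \sum_(i < d) if val i == d.-1 then cos (nth 0 th i / 2) else cos (nth 0 th i).
Proof.
rewrite -sum_split_last; congr (_ + _).
have h : (d.-1 < d)%N by rewrite prednK.
rewrite (big_pred1 (Ordinal h)) // => i; by rewrite -val_eqE.
Qed.

Lemma angle_sum_bound th : `|angle_sum th| <= d%:R.
Proof. by rewrite angle_sumE; exact: sum_cos_bound. Qed.

Lemma angle_sum_lip s s' :
  `|angle_sum s - angle_sum s'| <= \sum_(i < d) `|nth 0 s i - nth 0 s' i|.
Proof.
rewrite !angle_sumE -sumrB; apply: (le_trans (ler_norm_sum _ _ _)); apply: ler_sum => i _.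
case: ifP => _; last exact: cos_lip.
apply: (le_trans (cos_lip _ _ _)); rewrite -mulrBl normrM ler_piMr // ger0_norm ?invr_ge0 //.
by rewrite invf_le1 // ler1n.
Qed.

(** The coefficient of the square, times [2d] from [|a^2 - b^2| <= 2d |a - b|], over the lower bound
    of the argument of [ln]. *)
Definition log_density_lip : R := 4 * u / (d%:R ^+ 2) * (2 * d%:R) / (1 - u) ^+ 2.

Let u0 : 0 < u. Proof. by case/andP: u01. Qed.
Let u1 : u < 1. Proof. by case/andP: u01. Qed.
Let w0 : 0 < (1 - u) ^+ 2. Proof. by rewrite exprn_gt0 // subr_gt0. Qed.
Let c0 : 0 <= 4 * u / (d%:R ^+ 2).
Proof. by rewrite divr_ge0 ?exprn_ge0 // mulr_ge0 // ltW. Qed.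

Lemma log_density_lip_ge0 : 0 <= log_density_lip.
Proof. by rewrite /log_density_lip divr_ge0 ?(ltW w0) // mulr_ge0 // mulr_ge0. Qed.

Lemma log_density_lipn : lipn R log_density_lip d log_density.
Proof.
move=> s s'; have lb th := quadratic_lower R u (angle_sum th) d d0 u01 (angle_sum_bound th).
apply: (le_trans (ln_lip R _ _ _ w0 (lb s) (lb s'))).
rewrite /log_density_lip [leRHS]mulrAC ler_wpM2r ?invr_ge0 ?(ltW w0) //.
set a := angle_sum s; set b := angle_sum s'; set c := 4 * u / _.
have -> : (1 + u) ^+ 2 - c * a ^+ 2 - ((1 + u) ^+ 2 - c * b ^+ 2) = c * ((b + a) * (b - a)).
  by ring.
rewrite normrM (ger0_norm c0) -[leRHS]mulrA ler_wpM2l // normrM ler_pM //.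
  apply: (le_trans (ler_normD _ _)).
  by have := angle_sum_bound s; have := angle_sum_bound s'; rewrite -/a -/b; lra.
by rewrite distrC; exact: angle_sum_lip.
Qed.

(** The integrand lies between the two logarithms, of which the first is negative. *)
Definition log_density_bound : R := `|ln ((1 - u) ^+ 2)| + `|ln ((1 + u) ^+ 2)|.

Lemma log_density_le th : `|log_density th| <= log_density_bound.
Proof.
have lb := quadratic_lower R u (angle_sum th) d d0 u01 (angle_sum_bound th).
have ub : (1 + u) ^+ 2 - 4 * u / (d%:R ^+ 2) * angle_sum th ^+ 2 <= (1 + u) ^+ 2.
  by rewrite gerBl mulr_ge0 // sqr_ge0.
have x0 := lt_le_trans w0 lb; have y0 := lt_le_trans x0 ub.
rewrite -ler_ln ?posrE // in lb; rewrite -ler_ln ?posrE // in ub.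
rewrite -/(log_density th) in lb ub; rewrite /log_density_bound ler_norml.
have := ler_norm (ln ((1 + u) ^+ 2)); have := ler_norm (- ln ((1 - u) ^+ 2)).
rewrite normrN; have := normr_ge0 (ln ((1 + u) ^+ 2)); have := normr_ge0 (ln ((1 - u) ^+ 2)).
by move=> h1 h2 h3 h4; apply/andP; split; lra.
Qed.

End Integrand.

(** * Convergence of the spectral averages *)

Lemma torus_average_dist (R : realType) (d N : nat) (u : R) :
  (1 <= d)%N -> 0 < u < 1 -> (1 <= N)%N ->
  `|((2 * N) ^ d)%:R^-1 *
     \sum_(k : {ffun 'I_d -> 'I_(2 * N)} |
                   [forall i : 'I_d, (val i == d.-1) ==> (val (k i) < N)%N])
             ln ((1 + u) ^+ 2 - 4 * u / (d%:R ^+ 2) *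
                  (\sum_(i < d | val i != d.-1) cos ((val (k i))%:R * pi / N%:R)
                   + \sum_(i < d | val i == d.-1)
                       cos ((val (k i)).+1%:R * pi / N.+1%:R)) ^+ 2)
   - 2^-1 * torus_int d (log_density R d u)|
  <= d%:R * (2 * pi * log_density_lip R d u + 2 * log_density_bound R u) / N%:R.
Proof.
move=> d0 u01 N0; set T := 'I_(2 * N).
have N20 : (0 < 2 * N)%N by rewrite muln_gt0.
have N0' : 0 < N%:R :> R by rewrite ltr0n.
(* Zero weights encode the restriction on the last index; the last node is doubled in [q] because
   the integrand halves that angle. *)
pose w (i : 'I_d) (a : T) : R :=
  if val i == d.-1 then (if (a < N)%N then N%:R^-1 else 0) else (2 * N)%:R^-1.
pose q (i : 'I_d) (a : T) : R :=
  if val i == d.-1 then 2 * (a.+1%:R * pi / N.+1%:R) else a%:R * pi / N%:R.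
have C0 := log_density_lip_ge0 R d u u01.
have wsum i : \sum_a w i a = 1.
  rewrite /w; case: (val i == d.-1); last first.
    by rewrite sumr_const card_ord -[_ *+ _]mulr_natr mulVf // pnatr_eq0 -lt0n.
  rewrite -big_mkcond /= /T.
  have -> : \sum_(a < 2 * N | (a < N)%N) N%:R^-1 = \sum_(a < N) N%:R^-1 :> R.
    by rewrite [RHS](big_ord_widen (2 * N) (fun _ => N%:R^-1)) // leq_pmull.
  by rewrite sumr_const card_ord -[_ *+ _]mulr_natr mulVf // gt_eqF.
have w0 i a : 0 <= w i a by rewrite /w; case: ifP => _; [case: ifP|]; rewrite // ?invr_ge0.
set F := \sum_(k | _) _.
have QE : ((2 * N) ^ d)%:R^-1 * F = 2^-1 * \sum_(k : {ffun 'I_d -> T})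
    (\prod_i w i (k i)) * log_density R d u [seq q i (k i) | i <- enum 'I_d].
  rewrite /F big_mkcond !mulr_sumr; apply: eq_bigr => k _.
  have h : (d.-1 < d)%N by rewrite prednK.
  pose l := Ordinal h.
  have -> : [forall i : 'I_d, (val i == d.-1) ==> (val (k i) < N)%N] = (k l < N)%N.
    apply/forallP/idP => [/(_ l)|kN i]; first by rewrite eqxx.
    by apply/implyP => /eqP e; have -> : i = l by apply: val_inj.
  (* The last weight is [1/N = 2/(2N)]; this factor 2 is why [1/2] stands before the integral. *)
  have wE : \prod_i w i (k i) = if (k l < N)%N then 2 * ((2 * N) ^ d)%:R^-1 else 0.
    rewrite (bigD1 l) //= {1}/w eqxx (eq_bigr (fun _ => (2 * N)%:R^-1)) => [|i il]; last first.
      by rewrite /w ifN // -[d.-1]/(val l) val_eqE.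
    rewrite prodr_const; have -> : #|[pred i | i != l]| = d.-1.
      by have := cardC1 l; rewrite card_ord => <-; apply: eq_card.
    case: ifP => _; last by rewrite mul0r.
    have {2}-> : d = d.-1.+1 by rewrite prednK.
    rewrite natrX exprS exprVn natrM; field.
    by rewrite expf_neq0 ?mulf_neq0 ?gt_eqF.
  rewrite wE; case: ifP => _; last by rewrite mul0r !mulr0.
  rewrite -[in RHS]mulrA mulKf //; congr (_ * ln (_ - _ * _ ^+ 2)).
  rewrite angle_sumE // sum_split_last; apply: eq_bigr => i _.
  rewrite (nth_map i) ?size_enum_ord // nth_ord_enum /q; case: ifP => // _.
  by congr cos; rewrite [RHS]mulrAC divff // mul1r.

rewrite QE -mulrBr normrM ger0_norm ?invr_ge0 //.
set e := (2 * pi * _ + _); rewrite -mulrA.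
have we i g : lip R (log_density_lip R d u) g -> (forall t, `|g t| <= log_density_bound R u) ->
    `|\sum_a w i a * g (q i a) - mean R g| <= e / N%:R.
  by rewrite /w /q; case: (val i == d.-1) => ? ?; [exact: half_nodes|exact: full_nodes].
have H := torus_quadrature R _ C0 T (log_density_bound R u)
  (e / N%:R) d w q
  (log_density R d u) (Ordinal N20) w0 wsum we (log_density_lipn R d u d0 u01)
  (log_density_le R d u d0 u01).
by apply: le_trans H; rewrite ler_piMl // invf_le1 // ler1n.
Qed.

Theorem theorem2 (R : realType) (d : nat) (u : R) :
  (1 <= d)%N -> 0 < u < 1 ->
  (* Case 1 *)
  (forall N : nat, (2 <= N)%N ->
     (zeta ((2 * N) ^ d) (W1 R d N) u)^-1 =
       expR ((2 * d%:R - 2^-1) * ln (1 - u) + ln (1 + u))) /\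
  ((zeta ((2 * N) ^ d) (W1 R d N) u)^-1 @[N --> \oo] -->
       expR ((2 * d%:R - 2^-1) * ln (1 - u) + ln (1 + u))) /\
  (* Case 2 *)
  (forall N : nat, (2 <= N)%N ->
     (zeta ((2 * N) ^ d) (W2 R d N) u)^-1 =
       expR ((2 * d%:R - 2^-1) * ln (1 - u) +
         ((2 * N) ^ d)%:R^-1 *
           \sum_(k : {ffun 'I_d -> 'I_(2 * N)} |
                   [forall i : 'I_d, (val i == d.-1) ==> (val (k i) < N)%N])
             ln ((1 + u) ^+ 2 - 4 * u / (d%:R ^+ 2) *
                  (\sum_(i < d | val i != d.-1) cos ((val (k i))%:R * pi / N%:R)
                   + \sum_(i < d | val i == d.-1)
                       cos ((val (k i)).+1%:R * pi / N.+1%:R)) ^+ 2))) /\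
  ((zeta ((2 * N) ^ d) (W2 R d N) u)^-1 @[N --> \oo] -->
     expR ((2 * d%:R - 2^-1) * ln (1 - u) +
       2^-1 * torus_int d (fun th : seq R =>
         ln ((1 + u) ^+ 2 - 4 * u / (d%:R ^+ 2) *
              (\sum_(i < d | val i != d.-1) cos (nth 0 th i)
               + cos (nth 0 th d.-1 / 2)) ^+ 2)))).
Proof.
move=> d0 u01; split; [|split; [|split]].
- by move=> N N2; exact: zeta_W1.
(* The value does not depend on [N] once [N >= 2]. *)
- apply: cvg_near_cst; near=> N; apply: zeta_W1 => //; near: N; exact: nbhs_infty_ge.
- by move=> N N2; exact: zeta_W2.
set S := fun N : nat => ((2 * N) ^ d)%:R^-1 *
  \sum_(k : {ffun 'I_d -> 'I_(2 * N)} |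
          [forall i : 'I_d, (val i == d.-1) ==> (val (k i) < N)%N])
    ln ((1 + u) ^+ 2 - 4 * u / (d%:R ^+ 2) *
         (\sum_(i < d | val i != d.-1) cos ((val (k i))%:R * pi / N%:R)
          + \sum_(i < d | val i == d.-1)
              cos ((val (k i)).+1%:R * pi / N.+1%:R)) ^+ 2).
set I := torus_int d _.
have SI : S N @[N --> \oo] --> 2^-1 * I.
  apply/cvgrPdist_le => e e0.
  set K := d%:R * (2 * pi * log_density_lip R d u + 2 * log_density_bound R u).
  near=> N; have N1 : (1 <= N)%N by near: N; exact: nbhs_infty_ge.
  rewrite distrC; apply: (le_trans (torus_average_dist R d N u d0 u01 N1)).
  rewrite ler_pdivrMr ?ltr0n // [leRHS]mulrC -ler_pdivrMr //.
  by near: N; exact: nbhs_infty_ger.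
(* The closed formula holds for [N >= 2], hence eventually; continuity of [expR] then transports the
   limit of the averages. *)
apply: (@cvg_trans _ (expR ((2 * d%:R - 2^-1) * ln (1 - u) + S N) @[N --> \oo])).
  apply: near_eq_cvg; near=> N; rewrite zeta_W2 //.
  by near: N; exact: nbhs_infty_ge.
apply: continuous_cvg; first exact: continuous_expR.
by apply: cvgD => //; exact: cvg_cst.
Unshelve. all: by end_near.
Qed.
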